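(* Let $N\ge 1$, let $f_1,f_2,\dots,f_N\in \mathbf{P}^{\log}_{\mathbb{Q}}$ and let $\omega_1(z),\omega_2(z),\dots,\omega_N(z)\in\{\frac{dz}{z},\frac{dz}{1-z}\}$. If the iterated integral $$I(f_1,\dots,f_N;\omega_1,\dots,\omega_N)=\int\cdots\int_{0<z_1<z_2<\cdots<z_N<1} f_1(z_1)\omega_1(z_1)\,f_2(z_2)\omega_2(z_2)\cdots f_N(z_N)\omega_N(z_N)$$ is convergent, then its value is a $\mathbb{Q}$-linear combination of multiple zeta values.
   Context: For integers $k_1,\dots,k_r\ge 1$ ($r\ge 1$), the one variable multiple polylogarithm is $$\mathrm{Li}_{k_1,\dots,k_r}(z)=\sum_{0<n_1<n_2<\cdots<n_r}\frac{z^{n_r}}{n_1^{k_1}n_2^{k_2}\cdots n_r^{k_r}},\qquad |z|<1.$$ $\mathbf{P}^{\log}_{\mathbb{Q}}$ denotes the $\mathbb{Q}$-algebra of functions on the open interval $0<z<1$ generated by $1$ and all functions $\mathrm{Li}_{k_1,\dots,k_r}(z)$ and $\mathrm{Li}_{k_1,\dots,k_r}(1-z)$, for all $r\ge 1$ and $k_1,\dots,k_r\ge 1$. A multiple zeta value is a real number $\zeta(k_1,\dots,k_r)=\sum_{0<n_1<\cdots<n_r}\frac{1}{n_1^{k_1}\cdots n_r^{k_r}}$ with $r\ge 1$, $k_1,\dots,k_{r-1}\ge 1$ and $k_r\ge 2$. *)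

(* Defs.v *)
From Stdlib Require Import Reals QArith Qreals.
From Coquelicot Require Import Coquelicot.
From Stdlib Require Import List Arith.
Import ListNotations.
Open Scope R_scope.

(** An index (k_1, ..., k_r) is the list [k_1; ...; k_r]. *)
Definition is_index (k : list nat) : Prop :=
  k <> [] /\ Forall (fun j => (1 <= j)%nat) k.

Definition is_admissible_index (k : list nat) : Prop :=
  is_index k /\ (2 <= last k 0)%nat.

(** [nested_sum [k_s; ...; k_1] n] (largest summation variable first) is the sum
    of 1 / (n_1^k_1 ... n_s^k_s) over 0 < n_1 < ... < n_s < n; it is 1 for
    s = 0. *)
Fixpoint nested_sum (k : list nat) (n : nat) : R :=
  match k with
  | [] => 1
  | j :: k' => sum_n_m (fun m => / INR m ^ j * nested_sum k' m) 1 (pred n)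
  end.

(** Li_{k_1, ..., k_r}(z), as a series over n_r = S n. The value on the empty
    list, which is not an index, is never used. *)
Definition Li (k : list nat) (z : R) : R :=
  match rev k with
  | [] => 1
  | j :: k' => Series (fun n => z ^ S n / INR (S n) ^ j * nested_sum k' (S n))
  end.

Definition mzv (k : list nat) : R :=
  match rev k with
  | [] => 1
  | j :: k' => Series (fun n => / INR (S n) ^ j * nested_sum k' (S n))
  end.

Definition is_Q_linear_combination_of_mzv (v : R) : Prop :=
  exists l : list (Q * list nat),
    Forall (fun p => is_admissible_index (snd p)) l /\
    v = fold_right (fun p s => Q2R (fst p) * mzv (snd p) + s) 0 l.

(** Functions on (0,1) are represented by total functions R -> R, considered
    up to equality on (0,1), whence [Plog_ext]. *)
Inductive Plog : (R -> R) -> Prop :=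
  | Plog_one : Plog (fun _ => 1)
  | Plog_Li (k : list nat) : is_index k -> Plog (Li k)
  | Plog_Li_compl (k : list nat) : is_index k -> Plog (fun z => Li k (1 - z))
  | Plog_scal (q : Q) (f : R -> R) : Plog f -> Plog (fun z => Q2R q * f z)
  | Plog_add (f g : R -> R) : Plog f -> Plog g -> Plog (fun z => f z + g z)
  | Plog_mul (f g : R -> R) : Plog f -> Plog g -> Plog (fun z => f z * g z)
  | Plog_ext (f g : R -> R) :
      (forall z, 0 < z < 1 -> f z = g z) -> Plog f -> Plog g.

Inductive form : Set :=
  | dz_over_z
  | dz_over_1mz.

Definition density (w : form) (z : R) : R :=
  match w with
  | dz_over_z => / z
  | dz_over_1mz => / (1 - z)
  end.

(** [iter_int f w a n b] is the integral of f_1 w_1(z_1) ... f_n w_n(z_n) over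
    a < z_1 < ... < z_n < b. For 0 < a < b < 1 and f_i in Plog the integrands
    are continuous on [a, b], so that every [RInt] is a proper integral. *)
Fixpoint iter_int (f : nat -> R -> R) (w : nat -> form) (a : R) (n : nat)
    (b : R) : R :=
  match n with
  | O => 1
  | S m =>
      RInt (fun z => iter_int f w a m z * (f (S m) z * density (w (S m)) z)) a b
  end.

(** The integral over 0 < z_1 < ... < z_N < 1 converges, with value [v]. It is
    improper at both ends of (0,1): the limits a -> 0+ and then b -> 1- are
    required to exist (for N = 1 this is the usual improper integral). Absolute
    convergence over the simplex, and convergence of the successive improper
    integrals over z_1, z_2, ..., are both special cases. *)
Definition is_iterated_integral (N : nat) (f : nat -> R -> R)
    (w : nat -> form) (v : R) : Prop :=
  exists F : R -> R,
    (forall b, 0 < b < 1 ->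
       filterlim (fun a => iter_int f w a N b) (at_right 0) (locally (F b))) /\
    filterlim F (at_left 1) (locally v).

(* Main.v *)
Require Import Defs.
From Stdlib Require Import Reals QArith Qreals.
From Coquelicot Require Import Coquelicot.
From Stdlib Require Import Lra Lia List Arith.
Import ListNotations.
Open Scope R_scope.

(** Consider the functions on (0,1) that are polynomials in [ln z] and the
    polylogarithms, with coefficients in the ring [Q + Z], where [Z] is the
    span of the multiple zeta values ([log_span mzv_ring] below). They form an
    algebra, because a product of polylogarithms is a rational combination of
    polylogarithms (shuffle product, [polylogs_mul]), and every such function
    has a primitive of the same kind with respect to dz/z and dz/(1-z)
    ([log_span_primitive]). At 0 and at 1 such a function is a polynomial in
    [ln z], respectively in [Li1 z = - ln (1 - z)], plus o(1), and the constant
    term of this polynomial, the regularized limit, again lies in [Q + Z]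
    ([log_span_reg_lim_0], [log_span_reg_lim_1]).

    The function [Li k (1 - z)] belongs to the algebra as well: its derivative
    is a function of this type of smaller weight times one of the two forms, so it is
    minus a primitive, up to a constant that is the regularized limit of this
    primitive at 1 ([polylog_compl_step]). Hence [Plog] is contained in the
    algebra, and the iterated integral from [a] to [b] is a finite sum of
    products [c a * g b] of its elements ([iter_int_tensor]). If a function
    with a polynomial expansion in a logarithm converges, its limit is the
    constant term ([reg_lim_unique]). So the limit [a -> 0+] is computed by
    regularizing the factors [c], which leaves an element of the algebra in
    the variable [b], and the value of the integral is the regularized limit
    at 1 of this element, thus in [Q + Z].

    It has to be in [Z] itself. Therefore a second copy of the argument is
    carried along: the functions whose constant coefficient is in [Z]
    ([log_span mzv_span]) form an ideal, all primitives can be chosen in it,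
    and their regularized limits are in [Z], which is closed under
    multiplication by the shuffle product in the limit z -> 1.

    The regularized limit of a polylogarithm at 1 is found by writing it as a
    combination of [Li1^n] times polylogarithms that converge at 1
    ([polylog_Li1_expansion]); replacing the latter by their values costs only
    o(1), in spite of the factor [Li1^n] ([tail_mul_lim_1]). *)

(** * Polylogarithms as power series *)

Definition valid (l : list nat) : Prop := Forall (fun j => (1 <= j)%nat) l.

(** The index is reversed with respect to [Li], so that differentiation acts on
    the head of the list; [Li k] is [polylog (rev k)] by computation. *)
Definition polylog (l : list nat) (z : R) : R :=
  match l with
  | nil => 1
  | j :: k => Series (fun n => z ^ S n / INR (S n) ^ j * nested_sum k (S n))
  end.

Definition polylog_coef (j : nat) (k : list nat) (n : nat) : R :=
  match n with O => 0 | S _ => / INR n ^ j * nested_sum k n end.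

Lemma polylog_PSeries (j : nat) (k : list nat) (z : R) :
  polylog (j :: k) z = PSeries (polylog_coef j k) z.
Proof.
  unfold PSeries. rewrite Series_incr_1_aux by (simpl; ring).
  apply Series_ext. intros n.
  cbv [polylog_coef]. unfold Rdiv. ring.
Qed.

Lemma nested_sum_1 (j : nat) (k : list nat) : nested_sum (j :: k) 1 = 0.
Proof. simpl. rewrite sum_n_m_zero by lia. reflexivity. Qed.

Lemma nested_sum_S (j : nat) (k : list nat) (n : nat) : (1 <= n)%nat ->
  nested_sum (j :: k) (S n) =
  nested_sum (j :: k) n + / INR n ^ j * nested_sum k n.
Proof.
  intros Hn. destruct n as [|n]; [lia|].
  cbn [nested_sum pred]. rewrite sum_n_Sm by lia. reflexivity.
Qed.

Lemma inv_pow_pos (j n : nat) : (1 <= n)%nat -> 0 < / INR n ^ j.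
Proof.
  intros Hn. apply Rinv_0_lt_compat, pow_lt, lt_0_INR. lia.
Qed.

Lemma inv_pow_le (i j n : nat) : (1 <= n)%nat -> (i <= j)%nat ->
  / INR n ^ j <= / INR n ^ i.
Proof.
  intros Hn Hij. apply Rinv_le_contravar.
  - apply pow_lt, lt_0_INR; lia.
  - apply Rle_pow; [|exact Hij]. change 1 with (INR 1). apply le_INR; lia.
Qed.

Lemma nested_sum_nonneg (k : list nat) (n : nat) : (1 <= n)%nat ->
  0 <= nested_sum k n.
Proof.
  revert n. induction k as [|j k IH]; intros n Hn; [simpl; lra|].
  induction Hn as [|n Hn IHn].
  - rewrite nested_sum_1. lra.
  - rewrite nested_sum_S by exact Hn.
    generalize (Rmult_le_pos _ _ (Rlt_le _ _ (inv_pow_pos j n Hn)) (IH n Hn)).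
    lra.
Qed.

(** Exponent 1/2 is reproduced by the recursion, because
    [sqrt m / m = 1 / sqrt m] is at most [2 (sqrt m - sqrt (m - 1))]. *)
Lemma nested_sum_le_sqrt (k : list nat) : valid k ->
  exists C, 0 < C /\
    forall n, (1 <= n)%nat -> nested_sum k n <= C * sqrt (INR n).
Proof.
  induction 1 as [|j k Hj Hk [C [HC IH]]].
  - exists 1. split; [lra|]. intros n Hn. simpl nested_sum.
    rewrite Rmult_1_l, <- sqrt_1. apply sqrt_le_1_alt.
    change 1 with (INR 1). apply le_INR; lia.
  - exists (2 * C). split; [lra|].
    (* The sum stops before n, and the telescoping needs sqrt (n - 1). *)
    assert (H : forall n,
              nested_sum (j :: k) (S n) <= 2 * C * sqrt (INR n)).
    { induction n as [|n IHn].
      - rewrite nested_sum_1. generalize (sqrt_pos (INR 0)). nra.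
      - rewrite nested_sum_S by lia.
        assert (Hn : (1 <= S n)%nat) by lia.
        assert (H1 := inv_pow_le 1 j (S n) Hn Hj).
        assert (H2 := nested_sum_nonneg k (S n) Hn).
        assert (H3 := IH (S n) Hn).
        rewrite pow_1 in H1.
        assert (H4 : / INR (S n) ^ j * nested_sum k (S n)
                     <= / INR (S n) * (C * sqrt (INR (S n)))).
        { apply Rmult_le_compat; try assumption.
          left; apply inv_pow_pos; exact Hn. }
        rewrite S_INR in *.
        assert (Hp := pos_INR n).
        assert (Ht := sqrt_pos (INR n)).
        assert (Hs : 0 < sqrt (INR n + 1)) by (apply sqrt_lt_R0; lra).
        assert (E1 := sqrt_sqrt (INR n) Hp).
        assert (E2 := sqrt_sqrt (INR n + 1) ltac:(lra)).
        revert H4 IHn Ht Hs E1 E2.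
        generalize (sqrt (INR n)) (sqrt (INR n + 1)). intros t s H4 IHn Ht Hs E1 E2.
        rewrite <- E2 in H4 at 2.
        replace (/ (s * s) * (C * s)) with (C * / s) in H4 by (field; lra).
        assert (H6 : / s <= 2 * (s - t)).
        { apply Rmult_le_reg_r with s; [exact Hs|].
          rewrite Rinv_l by lra. nra. }
        nra. }
    intros n Hn. destruct n as [|n]; [lia|].
    eapply Rle_trans; [apply H|]. apply Rmult_le_compat_l; [lra|].
    apply sqrt_le_1_alt, le_INR; lia.
Qed.

Lemma polylog_coef_nonneg (j : nat) (k : list nat) (n : nat) :
  0 <= polylog_coef j k n.
Proof.
  destruct n as [|n]; [simpl; lra|]. unfold polylog_coef.
  apply Rmult_le_pos; [left; apply inv_pow_pos; lia|].
  apply nested_sum_nonneg; lia.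
Qed.

(** All these power series have bounded coefficients. *)
Lemma polylog_coef_radius (j : nat) (k : list nat) : valid (j :: k) ->
  Rbar_le 1 (CV_radius (polylog_coef j k)).
Proof.
  intros Hv. inversion Hv as [|? ? Hj Hk]; subst.
  destruct (nested_sum_le_sqrt k Hk) as [C [HC H]].
  apply (proj1 (CV_radius_bounded (polylog_coef j k))).
  exists C. intros n. rewrite pow1, Rmult_1_r.
  rewrite Rabs_pos_eq by apply polylog_coef_nonneg.
  destruct n as [|n]; [simpl; lra|]. unfold polylog_coef.
  assert (Hn : (1 <= S n)%nat) by lia.
  assert (H0 := inv_pow_le 1 j (S n) Hn Hj). rewrite pow_1 in H0.
  assert (H1 : / INR (S n) ^ j * nested_sum k (S n)
               <= / INR (S n) * (C * sqrt (INR (S n)))).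
  { apply Rmult_le_compat; auto using nested_sum_nonneg.
    left; apply inv_pow_pos; exact Hn. }
  eapply Rle_trans; [exact H1|].
  assert (H2 : 1 <= INR (S n)) by (change 1 with (INR 1); apply le_INR; lia).
  assert (H3 : 1 <= sqrt (INR (S n))) by (rewrite <- sqrt_1; apply sqrt_le_1_alt, H2).
  assert (E := sqrt_sqrt (INR (S n)) ltac:(lra)).
  revert H3 E. generalize (sqrt (INR (S n))). intros s H3 E.
  rewrite <- E. replace (/ (s * s) * (C * s)) with (C * / s) by (field; lra).
  rewrite <- (Rmult_1_r C) at 2. apply Rmult_le_compat_l; [lra|].
  rewrite <- Rinv_1. apply Rinv_le_contravar; lra.
Qed.

Lemma polylog_in_disk (j : nat) (k : list nat) (z : R) : valid (j :: k) ->
  Rabs z < 1 -> Rbar_lt (Rabs z) (CV_radius (polylog_coef j k)).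
Proof.
  intros Hv Hz. apply Rbar_lt_le_trans with 1; [exact Hz|].
  apply polylog_coef_radius, Hv.
Qed.

Lemma Rabs_lt_1 (z : R) : 0 < z < 1 -> Rabs z < 1.
Proof. intros Hz. apply Rabs_def1; lra. Qed.

Lemma polylog_nonneg (l : list nat) (z : R) : valid l -> 0 < z < 1 ->
  0 <= polylog l z.
Proof.
  intros Hv Hz. destruct l as [|j k]; [simpl; lra|].
  rewrite polylog_PSeries.
  rewrite <- (PSeries_const_0 z).
  unfold PSeries. apply Series_le.
  - intros n. rewrite Rmult_0_l. split; [lra|].
    apply Rmult_le_pos; [apply polylog_coef_nonneg|]. apply pow_le; lra.
  - assert (H := CV_radius_inside _ _ (polylog_in_disk j k z Hv (Rabs_lt_1 z Hz))).
    eapply ex_series_ext; [|exact H].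
    intros n. simpl. rewrite pow_n_pow. unfold scal; simpl. unfold mult; simpl. ring.
Qed.

Lemma is_derive_polylog_PSeries (j : nat) (k : list nat) (z : R) :
  valid (j :: k) -> 0 < z < 1 ->
  is_derive (polylog (j :: k)) z (PSeries (PS_derive (polylog_coef j k)) z).
Proof.
  intros Hv Hz.
  apply is_derive_ext with (PSeries (polylog_coef j k)).
  { intros t. symmetry. apply polylog_PSeries. }
  apply is_derive_PSeries, polylog_in_disk, Rabs_lt_1; assumption.
Qed.

Lemma is_derive_polylog_SS (j : nat) (k : list nat) (z : R) :
  valid k -> 0 < z < 1 ->
  is_derive (polylog (S (S j) :: k)) z (polylog (S j :: k) z * / z).
Proof.
  intros Hk Hz.
  assert (Hv : valid (S (S j) :: k)) by (constructor; [lia|exact Hk]).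
  replace (polylog (S j :: k) z * / z)
    with (PSeries (PS_derive (polylog_coef (S (S j)) k)) z).
  { apply is_derive_polylog_PSeries; assumption. }
  rewrite polylog_PSeries, (PSeries_decr_1_aux (polylog_coef (S j) k))
    by reflexivity.
  replace (z * PSeries (PS_decr_1 (polylog_coef (S j) k)) z * / z)
    with (PSeries (PS_decr_1 (polylog_coef (S j) k)) z) by (field; lra).
  apply PSeries_ext. intros n. unfold PS_derive, PS_decr_1, polylog_coef.
  assert (INR (S n) <> 0) by (apply not_0_INR; lia).
  rewrite <- tech_pow_Rmult. field. split; [apply pow_nonzero|]; assumption.
Qed.

(** Multiplication by [1 - z] takes differences of coefficients, and these
    undo the outermost partial sum in [nested_sum]. *)
Lemma is_derive_polylog_1 (k : list nat) (z : R) :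
  valid k -> 0 < z < 1 ->
  is_derive (polylog (1%nat :: k)) z (polylog k z * / (1 - z)).
Proof.
  intros Hk Hz.
  assert (Hv : valid (1%nat :: k)) by (constructor; [lia|exact Hk]).
  assert (Ha := Rabs_lt_1 z Hz).
  set (s := PS_derive (polylog_coef 1 k)).
  assert (Hs : forall n, s n = nested_sum k (S n)).
  { intros n. unfold s, PS_derive, polylog_coef. field. apply not_0_INR; lia. }
  assert (Hr : Rbar_lt (Rabs z) (CV_radius s)).
  { unfold s. rewrite CV_radius_derive. apply polylog_in_disk; assumption. }
  replace (polylog k z * / (1 - z)) with (PSeries s z).
  { apply is_derive_polylog_PSeries; assumption. }
  enough (E : PSeries s z - z * PSeries s z = polylog k z).
  { rewrite <- E. field. lra. }
  rewrite <- PSeries_incr_1, <- PSeries_minus.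
  2: apply CV_radius_inside; exact Hr.
  2: apply CV_radius_inside; rewrite CV_radius_incr_1; exact Hr.
  assert (Hex : ex_pseries (PS_minus s (PS_incr_1 s)) z).
  { apply ex_pseries_minus; apply CV_radius_inside;
      rewrite ?CV_radius_incr_1; exact Hr. }
  destruct k as [|i k].
  - rewrite PSeries_decr_1 by exact Hex.
    rewrite (PSeries_ext (PS_decr_1 _) (fun _ => 0)), PSeries_const_0.
    + unfold PS_minus, PS_plus, PS_opp, PS_incr_1. rewrite Hs.
      simpl. unfold plus, opp, zero; simpl. ring.
    + intros n. unfold PS_decr_1, PS_minus, PS_plus, PS_opp, PS_incr_1.
      rewrite !Hs. simpl. unfold plus, opp; simpl. ring.
  - rewrite polylog_PSeries. apply PSeries_ext. intros n.
    unfold PS_minus, PS_plus, PS_opp, PS_incr_1, polylog_coef.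
    destruct n as [|n]; rewrite !Hs.
    + rewrite nested_sum_1. unfold plus, opp, zero; simpl. ring.
    + rewrite (nested_sum_S i k (S n)) by lia.
      unfold plus, opp; simpl. ring.
Qed.

(** * Limits at the two ends of the interval *)

Lemma near_0 : at_right 0 (fun z => 0 < z < 1).
Proof.
  exists (mkposreal 1 Rlt_0_1). intros y Hy Hy0.
  unfold ball in Hy; simpl in Hy; unfold AbsRing_ball, abs, minus, plus, opp in Hy;
    simpl in Hy.
  apply Rabs_def2 in Hy. lra.
Qed.

Lemma near_1 : at_left 1 (fun z => 0 < z < 1).
Proof.
  exists (mkposreal 1 Rlt_0_1). intros y Hy Hy0.
  unfold ball in Hy; simpl in Hy; unfold AbsRing_ball, abs, minus, plus, opp in Hy;
    simpl in Hy.
  apply Rabs_def2 in Hy. lra.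
Qed.

Section Limits.
Context {F : (R -> Prop) -> Prop} {FF : ProperFilter F}.

Lemma lim_plus (f g : R -> R) (a b : R) :
  filterlim f F (locally a) -> filterlim g F (locally b) ->
  filterlim (fun z => f z + g z) F (locally (a + b)).
Proof.
  intros Hf Hg.
  apply (filterlim_comp_2 (G := locally a) (H := locally b) f g Rplus Hf Hg).
  exact (filterlim_plus (K := R_AbsRing) (V := R_NormedModule) a b).
Qed.

Lemma lim_mult (f g : R -> R) (a b : R) :
  filterlim f F (locally a) -> filterlim g F (locally b) ->
  filterlim (fun z => f z * g z) F (locally (a * b)).
Proof.
  intros Hf Hg.
  apply (filterlim_comp_2 (G := locally a) (H := locally b) f g Rmult Hf Hg).
  exact (filterlim_mult (K := R_AbsRing) a b).
Qed.

Lemma lim_const (c : R) : filterlim (fun _ : R => c) F (locally c).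
Proof. apply filterlim_const. Qed.

Lemma lim_scal (c : R) (f : R -> R) (a : R) :
  filterlim f F (locally a) ->
  filterlim (fun z => c * f z) F (locally (c * a)).
Proof. apply (lim_mult (fun _ => c)), lim_const. Qed.

Lemma lim_minus (f g : R -> R) (a b : R) :
  filterlim f F (locally a) -> filterlim g F (locally b) ->
  filterlim (fun z => f z - g z) F (locally (a - b)).
Proof.
  intros Hf Hg. replace (a - b) with (a + -1 * b) by ring.
  apply filterlim_ext with (fun z => f z + -1 * g z); [intros; ring|].
  apply lim_plus; [exact Hf|]. apply lim_scal, Hg.
Qed.

Lemma lim_unique (f : R -> R) (a b : R) :
  filterlim f F (locally a) -> filterlim f F (locally b) -> a = b.
Proof.
  intros Ha Hb.
  exact (filterlim_locally_unique (K := R_AbsRing) (V := R_NormedModule) f a b Ha Hb).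
Qed.

Lemma lim_0_squeeze (f g : R -> R) :
  F (fun z => Rabs (f z) <= g z) -> filterlim g F (locally 0) ->
  filterlim f F (locally 0).
Proof.
  intros Hle Hg. apply filterlim_locally. intros eps.
  assert (H := proj1 (filterlim_locally g 0) Hg eps).
  generalize (filter_and _ _ Hle H). apply filter_imp. intros z [H1 H2].
  unfold ball in *; simpl in *; unfold AbsRing_ball, abs, minus, plus, opp in *;
    simpl in *.
  rewrite Ropp_0, Rplus_0_r in *.
  apply Rle_lt_trans with (1 := H1).
  apply Rle_lt_trans with (2 := H2). apply Rle_abs.
Qed.

Lemma lim_le (f g : R -> R) (a b : R) :
  F (fun z => f z <= g z) ->
  filterlim f F (locally a) -> filterlim g F (locally b) -> a <= b.
Proof.
  intros H Hf Hg. exact (filterlim_le f g (Finite a) (Finite b) H Hf Hg).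
Qed.

Lemma lim_cast (f : R -> R) (a b : R) :
  a = b -> filterlim f F (locally a) -> filterlim f F (locally b).
Proof. intros <-. exact (fun H => H). Qed.

End Limits.

Lemma inv_ln_lim_0 : filterlim (fun z => / ln z) (at_right 0) (locally 0).
Proof.
  apply (filterlim_comp _ _ _ ln Rinv _ (Rbar_locally m_infty)).
  - exact is_lim_ln_0.
  - apply (filterlim_Rbar_inv m_infty). discriminate.
Qed.

Lemma ln_neg (z : R) : 0 < z < 1 -> ln z < 0.
Proof. intros Hz. rewrite <- ln_1. apply ln_increasing; lra. Qed.

Lemma exp_pow (x : R) (n : nat) : exp x ^ n = exp (INR n * x).
Proof.
  induction n as [|n IH].
  - simpl. rewrite Rmult_0_l, exp_0. reflexivity.
  - rewrite S_INR, Rmult_plus_distr_r, Rmult_1_l, exp_plus, <- IH. simpl. ring.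
Qed.

(** With [t = - ln z]: [t^i] is at most a multiple of [exp t / t], as [exp t]
    is the (i+1)-st power of [exp (t / (i + 1)) >= t / (i + 1)]. *)
Lemma mul_ln_pow_lim_0 (i : nat) :
  filterlim (fun z => z * ln z ^ i) (at_right 0) (locally 0).
Proof.
  set (C := INR (S i) ^ S i).
  apply lim_0_squeeze with (fun z => - C * / ln z).
  - generalize near_0. apply filter_imp. intros z Hz.
    assert (Hl := ln_neg z Hz).
    rewrite Rabs_mult, <- RPow_abs, (Rabs_left (ln z)) by exact Hl.
    rewrite Rabs_pos_eq by lra.
    set (t := - ln z). assert (Ht : 0 < t) by (unfold t; lra).
    replace (ln z) with (- t) by (unfold t; ring).
    replace (- C * / - t) with (C * / t) by (field; lra).
    assert (Hn : 0 < INR (S i)) by (apply lt_0_INR; lia).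
    assert (H1 : t / INR (S i) <= exp (t / INR (S i))).
    { generalize (exp_ineq1_le (t / INR (S i))). lra. }
    assert (H2 : (t / INR (S i)) ^ S i <= exp t).
    { replace t with (INR (S i) * (t / INR (S i))) at 2 by (field; lra).
      rewrite <- exp_pow. apply pow_incr. split; [|exact H1].
      apply Rmult_le_pos; [lra|]. left; apply Rinv_0_lt_compat, Hn. }
    assert (H3 : exp t = / z).
    { unfold t. rewrite exp_Ropp, exp_ln by lra. reflexivity. }
    rewrite H3 in H2.
    unfold Rdiv in H2. rewrite Rpow_mult_distr, pow_inv in H2.
    fold C in H2. assert (HC : 0 < C) by (apply pow_lt, Hn).
    apply Rmult_le_reg_r with (t * / z * / C).
    { repeat apply Rmult_lt_0_compat; try lra; apply Rinv_0_lt_compat; lra. }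
    replace (z * t ^ i * (t * / z * / C)) with (t ^ S i * / C)
      by (simpl; field; lra).
    replace (C * / t * (t * / z * / C)) with (/ z) by (field; lra).
    exact H2.
  - apply lim_cast with (- C * 0); [ring|]. apply lim_scal, inv_ln_lim_0.
Qed.

Lemma polylog_ln_pow_lim_0 (j : nat) (k : list nat) (i : nat) :
  valid (j :: k) ->
  filterlim (fun z => polylog (j :: k) z * ln z ^ i) (at_right 0) (locally 0).
Proof.
  intros Hv.
  set (h := PSeries (PS_decr_1 (polylog_coef j k))).
  apply filterlim_ext with (fun z => (z * ln z ^ i) * h z).
  { intros z. rewrite polylog_PSeries, PSeries_decr_1_aux by reflexivity.
    unfold h. ring. }
  apply lim_cast with (0 * h 0); [ring|].
  apply lim_mult; [apply mul_ln_pow_lim_0|].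
  apply (filterlim_filter_le_1 (F := locally 0) h); [apply filter_le_within|].
  apply (proj1 (continuity_pt_filterlim h 0)), PSeries_continuity.
  rewrite CV_radius_decr_1. apply polylog_in_disk; [exact Hv|].
  rewrite Rabs_R0. lra.
Qed.

Lemma polylog_lim_0 (j : nat) (k : list nat) : valid (j :: k) ->
  filterlim (polylog (j :: k)) (at_right 0) (locally 0).
Proof.
  intros Hv.
  apply filterlim_ext with (fun z => polylog (j :: k) z * ln z ^ 0).
  { intros z. simpl. ring. }
  apply polylog_ln_pow_lim_0, Hv.
Qed.

(** Multiple zeta values with the exponent of the largest summation variable
    first. *)
Definition mzv_desc (l : list nat) : R :=
  match l with
  | nil => 1
  | j :: k => Series (fun n => / INR (S n) ^ j * nested_sum k (S n))
  end.

(** The terms are at most [C n^(-3/2)], which telescopes against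
    [2 / sqrt n]. *)
Lemma ex_series_mzv (j : nat) (k : list nat) : valid k ->
  ex_series (fun n => / INR (S n) ^ S (S j) * nested_sum k (S n)).
Proof.
  intros Hk. destruct (nested_sum_le_sqrt k Hk) as [C [HC H]].
  set (a := fun n => / INR (S n) ^ S (S j) * nested_sum k (S n)).
  assert (Ha : forall n, 0 <= a n).
  { intros n. apply Rmult_le_pos; [left; apply inv_pow_pos; lia|].
    apply nested_sum_nonneg; lia. }
  assert (Hb : forall n, sum_n a n <= C * (3 - 2 / sqrt (INR (S n)))).
  { assert (Hle : forall n, a n <= C * / (sqrt (INR (S n)) ^ 3)).
    { intros n. unfold a.
      assert (Hn : (1 <= S n)%nat) by lia.
      assert (H1 := inv_pow_le 2 (S (S j)) (S n) Hn ltac:(lia)).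
      assert (H2 : / INR (S n) ^ S (S j) * nested_sum k (S n)
                   <= / INR (S n) ^ 2 * (C * sqrt (INR (S n)))).
      { apply Rmult_le_compat; auto using nested_sum_nonneg.
        left; apply inv_pow_pos; lia. }
      eapply Rle_trans; [exact H2|]. right.
      assert (Hp : 0 < INR (S n)) by (apply lt_0_INR; lia).
      assert (E := sqrt_sqrt (INR (S n)) (Rlt_le _ _ Hp)).
      assert (Hs := sqrt_lt_R0 _ Hp).
      rewrite <- E at 1. field. lra. }
    induction n as [|n IHn].
    - rewrite sum_O. eapply Rle_trans; [apply Hle|].
      simpl INR. rewrite sqrt_1. lra.
    - rewrite sum_Sn. unfold plus; simpl plus.
      eapply Rle_trans; [apply Rplus_le_compat; [exact IHn|apply Hle]|].
      rewrite <- Rmult_plus_distr_l. apply Rmult_le_compat_l; [lra|].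
      rewrite (S_INR (S n)).
      assert (Hp : 0 < INR (S n)) by (apply lt_0_INR; lia).
      assert (E1 := sqrt_sqrt (INR (S n)) (Rlt_le _ _ Hp)).
      assert (E2 := sqrt_sqrt (INR (S n) + 1) ltac:(lra)).
      assert (Ht := sqrt_lt_R0 _ Hp).
      assert (Hs := sqrt_lt_R0 (INR (S n) + 1) ltac:(lra)).
      revert E1 E2 Ht Hs.
      generalize (sqrt (INR (S n))) (sqrt (INR (S n) + 1)).
      intros t s E1 E2 Ht Hs.
      assert (Es : s * s - t * t = 1) by lra. clear E1 E2.
      apply Rmult_le_reg_r with (t * s ^ 3).
      { apply Rmult_lt_0_compat; [|apply pow_lt]; assumption. }
      replace ((3 - 2 / t + / s ^ 3) * (t * s ^ 3))
        with (3 * (t * s ^ 3) - 2 * s ^ 3 + t) by (field; lra).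
      replace ((3 - 2 / s) * (t * s ^ 3))
        with (3 * (t * s ^ 3) - 2 * (t * s ^ 2)) by (field; lra).
      (* [1 = (s - t) (s + t)] turns the claim into
         [t (s + t) <= 2 s^2]. *)
      assert (Hst : t < s) by nra.
      assert (t * (s + t) <= 2 * (s * s)) by nra.
      assert ((s - t) * (t * (s + t)) <= (s - t) * (2 * (s * s)))
        by (apply Rmult_le_compat_l; lra).
      replace ((s - t) * (t * (s + t))) with (t * (s * s - t * t)) in * by ring.
      rewrite Es in *. nra. }
  destruct (ex_finite_lim_seq_incr (sum_n a) (C * 3)) as [l Hl].
  - intros n. rewrite sum_Sn. change (sum_n a n <= sum_n a n + a (S n)).
    generalize (Ha (S n)). lra.
  - intros n. eapply Rle_trans; [apply Hb|]. apply Rmult_le_compat_l; [lra|].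
    assert (0 < 2 / sqrt (INR (S n))); [|lra].
    apply Rdiv_lt_0_compat; [lra|]. apply sqrt_lt_R0, lt_0_INR; lia.
  - exists l. exact Hl.
Qed.

(** Abel's theorem, unless the series converges beyond 1. *)
Lemma polylog_lim_1 (j : nat) (k : list nat) : valid k ->
  filterlim (polylog (S (S j) :: k)) (at_left 1)
    (locally (mzv_desc (S (S j) :: k))).
Proof.
  intros Hk.
  assert (Hv : valid (S (S j) :: k)) by (constructor; [lia|exact Hk]).
  set (a := polylog_coef (S (S j)) k).
  assert (E : mzv_desc (S (S j) :: k) = PSeries a 1).
  { unfold PSeries. rewrite Series_incr_1_aux by (simpl; ring).
    apply Series_ext. intros n. rewrite pow1. unfold a, polylog_coef. ring. }
  rewrite E.
  apply filterlim_ext with (PSeries a).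
  { intros z. symmetry. apply polylog_PSeries. }
  assert (Hr := polylog_coef_radius (S (S j)) k Hv). fold a in Hr.
  destruct (Rbar_le_lt_or_eq_dec _ _ Hr) as [Hlt|Heq].
  - apply (filterlim_filter_le_1 (F := locally 1) (PSeries a));
      [apply filter_le_within|].
    apply (proj1 (continuity_pt_filterlim (PSeries a) 1)), PSeries_continuity.
    rewrite Rabs_R1. exact Hlt.
  - assert (HA := Abel a). rewrite <- Heq in HA. apply HA; simpl; try lra.
    unfold ex_pseries. apply ex_series_incr_1.
    eapply ex_series_ext; [|apply (ex_series_mzv j k Hk)].
    intros n. rewrite pow_n_pow, pow1.
    unfold scal; simpl; unfold mult; simpl. ring.
Qed.

(** * Spans of functions on the interval, and primitives *)

(** Only values on (0,1) count, whence [span_ext]. *)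
Inductive span (K : R -> Prop) (B : (R -> R) -> Prop) : (R -> R) -> Prop :=
  | span_zero : span K B (fun _ => 0)
  | span_base (f : R -> R) : B f -> span K B f
  | span_add (f g : R -> R) :
      span K B f -> span K B g -> span K B (fun z => f z + g z)
  | span_scal (c : R) (f : R -> R) :
      K c -> span K B f -> span K B (fun z => c * f z)
  | span_ext (f g : R -> R) :
      (forall z, 0 < z < 1 -> f z = g z) -> span K B f -> span K B g.

Lemma span_mono (K K' : R -> Prop) (B B' : (R -> R) -> Prop) (f : R -> R) :
  (forall c, K c -> K' c) -> (forall g, B g -> span K' B' g) ->
  span K B f -> span K' B' f.
Proof.
  intros HK HB. induction 1; eauto using span.
Qed.

Lemma span_mul (K : R -> Prop) (B1 B2 B3 : (R -> R) -> Prop) (f g : R -> R) :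
  (forall u v, B1 u -> B2 v -> span K B3 (fun z => u z * v z)) ->
  span K B1 f -> span K B2 g -> span K B3 (fun z => f z * g z).
Proof.
  intros HB Hf Hg. induction Hf as [|f Hf|f1 f2 _ IH1 _ IH2|c f Hc _ IH|f1 f2 E _ IH].
  - apply span_ext with (fun _ => 0); [intros; ring|constructor].
  - induction Hg as [|g Hg|g1 g2 _ IH1 _ IH2|c g Hc _ IH|g1 g2 E _ IH].
    + apply span_ext with (fun _ => 0); [intros; ring|constructor].
    + auto.
    + apply span_ext with (2 := span_add _ _ _ _ IH1 IH2). intros; ring.
    + apply span_ext with (2 := span_scal _ _ c _ Hc IH). intros; ring.
    + apply span_ext with (2 := IH). intros z Hz. rewrite (E z Hz). reflexivity.
  - apply span_ext with (2 := span_add _ _ _ _ IH1 IH2). intros; ring.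
  - apply span_ext with (2 := span_scal _ _ c _ Hc IH). intros; ring.
  - apply span_ext with (2 := IH). intros z Hz. rewrite (E z Hz). reflexivity.
Qed.

Definition primitive (W f G : R -> R) : Prop :=
  forall z, 0 < z < 1 -> is_derive G z (f z * W z).

(** The normalization at 0 makes a primitive unique. It is not available for
    dz/z alone, whose primitive is the logarithm. *)
Definition primitive0 (W f G : R -> R) : Prop :=
  primitive W f G /\ filterlim G (at_right 0) (locally 0).

Lemma is_derive_cast (f : R -> R) (z a b : R) :
  a = b -> is_derive f z a -> is_derive f z b.
Proof. intros <-. exact (fun H => H). Qed.

Lemma is_derive_add (f g : R -> R) (z a b : R) :
  is_derive f z a -> is_derive g z b ->
  is_derive (fun t => f t + g t) z (a + b).
Proof. exact (is_derive_plus f g z a b). Qed.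

Lemma is_derive_mul (f g : R -> R) (z a b : R) :
  is_derive f z a -> is_derive g z b ->
  is_derive (fun t => f t * g t) z (a * g z + f z * b).
Proof. intros Hf Hg. exact (is_derive_mult f g z a b Hf Hg Rmult_comm). Qed.

Lemma is_derive_cmul (c : R) (f : R -> R) (z a : R) :
  is_derive f z a -> is_derive (fun t => c * f t) z (c * a).
Proof. exact (is_derive_scal f z c a). Qed.

Lemma is_derive_powR (f : R -> R) (n : nat) (z a : R) :
  is_derive f z a ->
  is_derive (fun t => f t ^ S n) z (INR (S n) * a * f z ^ n).
Proof. exact (is_derive_pow f (S n) z a). Qed.

Lemma primitive_zero (W : R -> R) : primitive W (fun _ => 0) (fun _ => 0).
Proof.
  intros z Hz. rewrite Rmult_0_l. exact (is_derive_const (0 : R_NormedModule) z).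
Qed.

Lemma primitive_add (W f g F G : R -> R) :
  primitive W f F -> primitive W g G ->
  primitive W (fun z => f z + g z) (fun z => F z + G z).
Proof.
  intros HF HG z Hz. rewrite Rmult_plus_distr_r. apply is_derive_add; auto.
Qed.

Lemma primitive_scal (W f F : R -> R) (c : R) :
  primitive W f F -> primitive W (fun z => c * f z) (fun z => c * F z).
Proof.
  intros HF z Hz. rewrite Rmult_assoc. apply is_derive_cmul; auto.
Qed.

Lemma primitive_ext (W f g F : R -> R) :
  (forall z, 0 < z < 1 -> f z = g z) -> primitive W f F -> primitive W g F.
Proof. intros E HF z Hz. rewrite <- (E z Hz). auto. Qed.

Lemma primitive0_ext (W f g F : R -> R) :
  (forall z, 0 < z < 1 -> f z = g z) -> primitive0 W f F -> primitive0 W g F.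
Proof. intros E [H H0]. split; [eapply primitive_ext; eauto|exact H0]. Qed.

Lemma span_primitive (K : R -> Prop) (B B' : (R -> R) -> Prop) (W f : R -> R) :
  (forall g, B g -> exists G, span K B' G /\ primitive W g G) ->
  span K B f -> exists G, span K B' G /\ primitive W f G.
Proof.
  intros HB Hf.
  induction Hf as [|f Hf|f g _ [F [SF HF]] _ [G [SG HG]]|c f Hc _ [F [SF HF]]
                  |f g E _ [F [SF HF]]].
  - eexists; split; [apply span_zero|apply primitive_zero].
  - auto.
  - eexists; split; [exact (span_add _ _ _ _ SF SG)|apply primitive_add; assumption].
  - eexists; split; [exact (span_scal _ _ _ _ Hc SF)|apply primitive_scal; assumption].
  - exists F; split; [exact SF|exact (primitive_ext _ _ _ _ E HF)].
Qed.

Lemma span_primitive0 (K : R -> Prop) (B B' : (R -> R) -> Prop) (W f : R -> R) :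
  (forall g, B g -> exists G, span K B' G /\ primitive0 W g G) ->
  span K B f -> exists G, span K B' G /\ primitive0 W f G.
Proof.
  intros HB Hf.
  induction Hf as [|f Hf|f g _ [F [SF [HF LF]]] _ [G [SG [HG LG]]]
                  |c f Hc _ [F [SF [HF LF]]]|f g E _ [F [SF HF]]].
  - eexists; split; [apply span_zero|]. split; [apply primitive_zero|].
    apply filterlim_const.
  - auto.
  - eexists; split; [exact (span_add _ _ _ _ SF SG)|].
    split; [apply primitive_add; assumption|].
    apply lim_cast with (0 + 0); [ring|]. apply lim_plus; assumption.
  - eexists; split; [exact (span_scal _ _ _ _ Hc SF)|].
    split; [apply primitive_scal; assumption|].
    apply lim_cast with (c * 0); [ring|]. apply lim_scal; assumption.
  - exists F; split; [exact SF|exact (primitive0_ext _ _ _ _ E HF)].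
Qed.

Lemma derive_0_const (h : R -> R) :
  (forall z, 0 < z < 1 -> is_derive h z 0) ->
  forall x y, 0 < x < 1 -> 0 < y < 1 -> h x = h y.
Proof.
  intros Hd.
  assert (H : forall x y, 0 < x < 1 -> 0 < y < 1 -> x < y -> h x = h y).
  { intros x y Hx Hy Hxy. apply (eq_is_derive h x y); [|exact Hxy].
    intros t Ht. apply Hd. lra. }
  intros x y Hx Hy. destruct (Rtotal_order x y) as [L|[->|L]].
  - apply H; assumption.
  - reflexivity.
  - symmetry. apply H; assumption.
Qed.

Lemma same_derive (f g d : R -> R) :
  (forall z, 0 < z < 1 -> is_derive f z (d z)) ->
  (forall z, 0 < z < 1 -> is_derive g z (d z)) ->
  forall x y, 0 < x < 1 -> 0 < y < 1 -> f x - g x = f y - g y.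
Proof.
  intros Hf Hg. apply (derive_0_const (fun z => f z - g z)). intros z Hz.
  apply is_derive_cast with (d z - d z); [ring|].
  exact (is_derive_minus f g z (d z) (d z) (Hf z Hz) (Hg z Hz)).
Qed.

Lemma same_derive_lim_0 (f g d : R -> R) :
  (forall z, 0 < z < 1 -> is_derive f z (d z)) ->
  (forall z, 0 < z < 1 -> is_derive g z (d z)) ->
  filterlim f (at_right 0) (locally 0) ->
  filterlim g (at_right 0) (locally 0) ->
  forall z, 0 < z < 1 -> f z = g z.
Proof.
  intros Hf Hg Lf Lg z Hz.
  enough (f z - g z = 0) by lra.
  apply (lim_unique (F := at_right 0) (fun t => f t - g t)).
  - apply filterlim_ext_loc with (fun _ => f z - g z); [|apply filterlim_const].
    generalize near_0. apply filter_imp. intros t Ht.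
    apply (same_derive f g d Hf Hg); assumption.
  - apply lim_cast with (0 - 0); [ring|]. apply lim_minus; assumption.
Qed.

(** * Products of polylogarithms *)

Definition rational (c : R) : Prop := exists q : Q, c = Q2R q.

Definition polylogs0 (f : R -> R) : Prop :=
  exists l, valid l /\ f = polylog l.
Definition polylogs (f : R -> R) : Prop :=
  exists j k, valid (j :: k) /\ f = polylog (j :: k).
Definition adm_polylogs (f : R -> R) : Prop :=
  exists j k, valid k /\ f = polylog (S (S j) :: k).

Lemma valid_cons (j : nat) (k : list nat) :
  (1 <= j)%nat -> valid k -> valid (j :: k).
Proof. intros; constructor; assumption. Qed.

Lemma adm_span (f : R -> R) : span rational adm_polylogs f -> span rational polylogs f.
Proof.
  apply span_mono; [auto|]. intros g (j & k & Hk & ->).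
  apply span_base. exists (S (S j)), k. split; [|reflexivity].
  apply valid_cons; [lia|exact Hk].
Qed.

Lemma primitive_dz_over_z (f : R -> R) : span rational polylogs f ->
  exists G, span rational adm_polylogs G /\ primitive0 Rinv f G.
Proof.
  apply span_primitive0. intros g (j & k & Hv & ->).
  inversion Hv as [|? ? Hj Hk]; subst. destruct j as [|j]; [lia|].
  exists (polylog (S (S j) :: k)). split; [|split].
  - apply span_base. exists j, k. auto.
  - intros z Hz. apply is_derive_polylog_SS; assumption.
  - apply polylog_lim_0, valid_cons; [lia|exact Hk].
Qed.

Lemma primitive_dz_over_1mz (f : R -> R) : span rational polylogs0 f ->
  exists G, span rational polylogs G /\ primitive0 (fun z => / (1 - z)) f G.
Proof.
  apply span_primitive0. intros g (l & Hl & ->).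
  exists (polylog (1%nat :: l)). split; [|split].
  - apply span_base. exists 1%nat, l. split; [|reflexivity].
    apply valid_cons; [lia|exact Hl].
  - intros z Hz. apply is_derive_polylog_1; assumption.
  - apply polylog_lim_0, valid_cons; [lia|exact Hl].
Qed.

Lemma polylogs_polylogs0 (f : R -> R) :
  span rational polylogs f -> span rational polylogs0 f.
Proof.
  apply span_mono; [auto|]. intros g (j & k & Hv & ->).
  apply span_base. exists (j :: k). auto.
Qed.

(** One of the two halves of the Leibniz rule for [polylog (j :: k) * g],
    integrated. The derivative [d] is a polylogarithm of smaller weight times
    dz/z or dz/(1-z), and only dz/z occurs if [j] is at least 2, whence the
    admissible primitive. *)
Lemma half_product (j : nat) (k : list nat) (g : R -> R) :
  valid (j :: k) ->
  (forall l, valid l -> (list_sum l < list_sum (j :: k))%nat ->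
     span rational polylogs (fun z => polylog l z * g z)) ->
  exists d G, span rational polylogs G /\
    ((2 <= j)%nat -> span rational adm_polylogs G) /\
    (forall z, 0 < z < 1 -> is_derive (polylog (j :: k)) z (d z)) /\
    primitive0 d g G.
Proof.
  intros Hv IH. inversion Hv as [|? ? Hj Hk]; subst.
  destruct j as [|[|j]]; [lia| |].
  - destruct (primitive_dz_over_1mz (fun z => polylog k z * g z)) as [G [SG [HG LG]]].
    { apply polylogs_polylogs0, IH; [exact Hk|simpl; lia]. }
    exists (fun z => polylog k z * / (1 - z)), G.
    split; [exact SG|]. split; [lia|]. split.
    + intros z Hz. apply is_derive_polylog_1; assumption.
    + split; [|exact LG]. intros z Hz.
      apply is_derive_cast with (2 := HG z Hz). ring.
  - destruct (primitive_dz_over_z (fun z => polylog (S j :: k) z * g z))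
      as [G [SG [HG LG]]].
    { apply IH; [apply valid_cons; [lia|exact Hk]|simpl; lia]. }
    exists (fun z => polylog (S j :: k) z * / z), G.
    split; [apply adm_span, SG|]. split; [intros _; exact SG|]. split.
    + intros z Hz. apply is_derive_polylog_SS; assumption.
    + split; [|exact LG]. intros z Hz.
      apply is_derive_cast with (2 := HG z Hz). ring.
Qed.

Lemma Leibniz_product (i j : nat) (k l : list nat) (d e G H : R -> R) :
  valid (i :: k) -> valid (j :: l) ->
  (forall z, 0 < z < 1 -> is_derive (polylog (i :: k)) z (d z)) ->
  (forall z, 0 < z < 1 -> is_derive (polylog (j :: l)) z (e z)) ->
  primitive0 d (polylog (j :: l)) G -> primitive0 e (polylog (i :: k)) H ->
  forall z, 0 < z < 1 -> G z + H z = polylog (i :: k) z * polylog (j :: l) z.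
Proof.
  intros Vk Vl Hd He [HG LG] [HH LH].
  apply (same_derive_lim_0 (fun z => G z + H z)
           (fun z => polylog (i :: k) z * polylog (j :: l) z)
           (fun z => polylog (j :: l) z * d z + polylog (i :: k) z * e z)).
  - intros z Hz. apply is_derive_add; auto.
  - intros z Hz.
    apply is_derive_cast with (2 := is_derive_mul _ _ _ _ _ (Hd z Hz) (He z Hz)).
    ring.
  - apply lim_cast with (0 + 0); [ring|]. apply lim_plus; assumption.
  - apply lim_cast with (0 * 0); [ring|].
    apply lim_mult; apply polylog_lim_0; assumption.
Qed.

(** The shuffle product, by induction on the weight: the two terms of the
    derivative are products of smaller weight times dz/z or dz/(1-z). *)
Lemma polylogs_mul (f g : R -> R) :
  span rational polylogs f -> span rational polylogs g ->
  span rational polylogs (fun z => f z * g z).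
Proof.
  apply span_mul. intros u v (i & k & Hk & ->) (j & l & Hl & ->).
  remember (list_sum (i :: k) + list_sum (j :: l))%nat as n eqn:En.
  revert i k j l Hk Hl En.
  induction n as [n IH] using lt_wf_ind. intros i k j l Hk Hl ->.
  destruct (half_product i k (polylog (j :: l)) Hk) as (d & G & SG & _ & Hd & HG).
  { intros [|i' k'] Hv Hs.
    - apply span_ext with (polylog (j :: l)); [intros; simpl; ring|].
      apply span_base. exists j, l. auto.
    - eapply IH; [|exact Hv|exact Hl|reflexivity]. lia. }
  destruct (half_product j l (polylog (i :: k)) Hl) as (e & H & SH & _ & He & HH).
  { intros [|i' k'] Hv Hs.
    - apply span_ext with (polylog (i :: k)); [intros; simpl; ring|].
      apply span_base. exists i, k. auto.
    - eapply IH; [|exact Hv|exact Hk|reflexivity]. lia. }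
  apply span_ext with (2 := span_add _ _ _ _ SG SH).
  exact (Leibniz_product i j k l d e G H Hk Hl Hd He HG HH).
Qed.

Lemma adm_polylogs_mul (f g : R -> R) :
  span rational adm_polylogs f -> span rational adm_polylogs g ->
  span rational adm_polylogs (fun z => f z * g z).
Proof.
  assert (Hm : forall l j k, valid l -> valid (j :: k) ->
            span rational polylogs (fun z => polylog l z * polylog (j :: k) z)).
  { intros l j k Hl Hv.
    assert (Hb : span rational polylogs (polylog (j :: k))).
    { apply span_base. exists j, k. auto. }
    destruct l as [|i l].
    - apply span_ext with (2 := Hb). intros; simpl; ring.
    - apply polylogs_mul; [|exact Hb]. apply span_base. exists i, l. auto. }
  apply span_mul. intros u v (i & k & Hk & ->) (j & l & Hl & ->).
  assert (Vk : valid (S (S i) :: k)) by (apply valid_cons; [lia|exact Hk]).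
  assert (Vl : valid (S (S j) :: l)) by (apply valid_cons; [lia|exact Hl]).
  destruct (half_product _ _ (polylog (S (S j) :: l)) Vk)
    as (d & G & _ & SG & Hd & HG); [auto|].
  destruct (half_product _ _ (polylog (S (S i) :: k)) Vl)
    as (e & H & _ & SH & He & HH); [auto|].
  apply span_ext with (2 := span_add _ _ _ _ (SG ltac:(lia)) (SH ltac:(lia))).
  exact (Leibniz_product _ _ _ _ d e G H Vk Vl Hd He HG HH).
Qed.

(** * The ring of multiple zeta values *)

Notation mzv_span := is_Q_linear_combination_of_mzv (only parsing).

Lemma mzv_span_0 : mzv_span 0.
Proof. exists []. split; [constructor|reflexivity]. Qed.

Lemma mzv_span_add (x y : R) : mzv_span x -> mzv_span y -> mzv_span (x + y).
Proof.
  intros (l & Hl & ->) (m & Hm & ->). exists (l ++ m). split.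
  - apply Forall_app; auto.
  - clear Hl Hm. induction l as [|p l IH]; simpl; [ring|]. rewrite <- IH. ring.
Qed.

Lemma mzv_span_scal (c x : R) : rational c -> mzv_span x -> mzv_span (c * x).
Proof.
  intros [q ->] (l & Hl & ->).
  exists (map (fun p => ((q * fst p)%Q, snd p)) l). split.
  - apply Forall_map. exact Hl.
  - clear Hl. induction l as [|p l IH]; simpl; [ring|].
    rewrite <- IH, Q2R_mult. ring.
Qed.

Lemma adm_rev (k : list nat) : is_admissible_index k <->
  exists j l, valid l /\ rev k = S (S j) :: l.
Proof.
  split.
  - intros [[Hk Hv] Hlast].
    destruct (exists_last Hk) as (l & i & ->). rewrite last_last in Hlast.
    apply Forall_app in Hv. destruct Hv as [Hv _].
    destruct i as [|[|i]]; [lia|lia|].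
    exists i, (rev l). split; [apply Forall_rev, Hv|].
    rewrite rev_app_distr. reflexivity.
  - intros (j & l & Hl & E).
    rewrite <- (rev_involutive k), E. cbn [rev]. split; [split|].
    + destruct (rev l); discriminate.
    + apply Forall_app. split; [apply Forall_rev, Hl|]. constructor; [lia|constructor].
    + rewrite last_last. lia.
Qed.

Lemma mzv_span_desc (j : nat) (k : list nat) :
  valid k -> mzv_span (mzv_desc (S (S j) :: k)).
Proof.
  intros Hk. exists [(1%Q, rev (S (S j) :: k))]. split.
  - constructor; [|constructor]. apply adm_rev. exists j, k.
    split; [exact Hk|]. apply rev_involutive.
  - cbn [fold_right fst snd]. unfold mzv. rewrite rev_involutive.
    rewrite RMicromega.Q2R_1. unfold mzv_desc. ring.
Qed.

Lemma adm_lim_1 (f : R -> R) : span rational adm_polylogs f ->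
  exists c, mzv_span c /\ filterlim f (at_left 1) (locally c).
Proof.
  intros Hf.
  induction Hf as [|f (j & k & Hk & ->)|f g _ [a [Ha Lf]] _ [b [Hb Lg]]
                  |c f Hc _ [a [Ha Lf]]|f g E _ [a [Ha Lf]]].
  - exists 0. split; [apply mzv_span_0|apply lim_const].
  - eexists; split; [apply (mzv_span_desc j k Hk)|apply polylog_lim_1, Hk].
  - exists (a + b). split; [apply mzv_span_add; assumption|apply lim_plus; assumption].
  - exists (c * a). split; [apply mzv_span_scal; assumption|apply lim_scal; assumption].
  - exists a. split; [exact Ha|].
    apply filterlim_ext_loc with (2 := Lf).
    generalize near_1. apply filter_imp, E.
Qed.

(** Converse of [adm_lim_1]; the two together transport the product of
    functions to [mzv_span]. *)
Lemma mzv_span_is_lim (c : R) : mzv_span c ->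
  exists f, span rational adm_polylogs f /\ filterlim f (at_left 1) (locally c).
Proof.
  intros (l & Hl & ->). induction Hl as [|[q k] l Hk _ (f & Sf & Lf)].
  - exists (fun _ => 0). split; [constructor|apply lim_const].
  - apply adm_rev in Hk. destruct Hk as (j & k' & Hv & E).
    exists (fun z => Q2R q * polylog (S (S j) :: k') z + f z). split.
    + apply span_add; [apply span_scal|exact Sf].
      * exists q. reflexivity.
      * apply span_base. exists j, k'. auto.
    + cbn [fold_right fst snd].
      apply (lim_plus (fun z => Q2R q * _)); [|exact Lf]. apply lim_scal.
      simpl in E. unfold mzv. rewrite E. apply polylog_lim_1, Hv.
Qed.

(** The shuffle relations, in the limit. *)
Lemma mzv_span_mul (x y : R) : mzv_span x -> mzv_span y -> mzv_span (x * y).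
Proof.
  intros Hx Hy.
  destruct (mzv_span_is_lim x Hx) as (f & Sf & Lf).
  destruct (mzv_span_is_lim y Hy) as (g & Sg & Lg).
  destruct (adm_lim_1 _ (adm_polylogs_mul f g Sf Sg)) as (c & Hc & Lc).
  rewrite (lim_unique _ _ _ (lim_mult _ _ _ _ Lf Lg) Lc). exact Hc.
Qed.

(** Coefficients are taken in [Q + mzv_span], but constants of integration
    have to be traced to the ideal [mzv_span] of this ring, as 1 itself is
    not known to lie in it. *)
Definition mzv_ring (x : R) : Prop :=
  exists c y, rational c /\ mzv_span y /\ x = c + y.

Definition mzv_ideal (P : R -> Prop) : Prop :=
  P 0 /\ (forall x y, P x -> P y -> P (x + y)) /\
  (forall x y, mzv_ring x -> P y -> P (x * y)) /\
  (forall x, mzv_span x -> P x) /\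
  (forall x, P x -> mzv_ring x).

Lemma rational_Q2R (q : Q) : rational (Q2R q).
Proof. exists q. reflexivity. Qed.

Lemma rational_add (x y : R) : rational x -> rational y -> rational (x + y).
Proof. intros [p ->] [q ->]. exists (p + q)%Q. symmetry. apply Q2R_plus. Qed.

Lemma rational_mul (x y : R) : rational x -> rational y -> rational (x * y).
Proof. intros [p ->] [q ->]. exists (p * q)%Q. symmetry. apply Q2R_mult. Qed.

Lemma rational_opp (x : R) : rational x -> rational (- x).
Proof. intros [p ->]. exists (- p)%Q. symmetry. apply Q2R_opp. Qed.

Lemma rational_INR (n : nat) : rational (INR n).
Proof.
  exists (inject_Z (Z.of_nat n)). unfold Q2R; simpl. rewrite INR_IZR_INZ. field.
Qed.

Lemma rational_inv_INR (n : nat) : rational (/ INR (S n)).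
Proof.
  destruct (rational_INR (S n)) as [q E].
  exists (/ q)%Q. rewrite Q2R_inv; [rewrite E; reflexivity|].
  intros H. apply Qeq_eqR in H. rewrite <- E in H.
  apply (not_0_INR (S n)); [lia|]. rewrite H. unfold Q2R; simpl; ring.
Qed.

Lemma rational_1 : rational 1.
Proof. exact (rational_INR 1). Qed.

Lemma rational_0 : rational 0.
Proof. exact (rational_INR 0). Qed.

Lemma mzv_ring_span (x : R) : mzv_span x -> mzv_ring x.
Proof. intros Hx. exists 0, x. split; [apply rational_0|]. split; [exact Hx|ring]. Qed.

Lemma mzv_ring_rational (x : R) : rational x -> mzv_ring x.
Proof. intros Hx. exists x, 0. split; [exact Hx|]. split; [apply mzv_span_0|ring]. Qed.

Lemma mzv_ideal_span : mzv_ideal mzv_span.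
Proof.
  split; [exact mzv_span_0|]. split; [exact mzv_span_add|].
  split; [|split; [auto|exact mzv_ring_span]].
  intros x y (c & u & Hc & Hu & ->) Hy. rewrite Rmult_plus_distr_r.
  apply mzv_span_add; [apply mzv_span_scal|apply mzv_span_mul]; assumption.
Qed.

Lemma mzv_ideal_ring : mzv_ideal mzv_ring.
Proof.
  split; [apply mzv_ring_rational, rational_0|]. split; [|split].
  - intros x y (c & u & Hc & Hu & ->) (d & v & Hd & Hv & ->).
    exists (c + d), (u + v). split; [apply rational_add; assumption|].
    split; [apply mzv_span_add; assumption|ring].
  - intros x y Hx (d & v & Hd & Hv & ->).
    destruct Hx as (c & u & Hc & Hu & ->).
    exists (c * d), (c * v + (d * u + u * v)).
    split; [apply rational_mul; assumption|]. split; [|ring].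
    apply mzv_span_add; [apply mzv_span_scal; assumption|].
    apply mzv_span_add; [apply mzv_span_scal; assumption|].
    apply mzv_span_mul; assumption.
  - split; [exact mzv_ring_span|auto].
Qed.

(** * Regularized limits *)

Fixpoint peval (p : list R) (t : R) : R :=
  match p with
  | [] => 0
  | c :: q => c + t * peval q t
  end.

Lemma peval_add (p q : list R) :
  exists r, forall t, peval r t = peval p t + peval q t.
Proof.
  revert q. induction p as [|c p IH]; intros q.
  - exists q. intros t; simpl; ring.
  - destruct q as [|d q].
    + exists (c :: p). intros t; simpl; ring.
    + destruct (IH q) as [r Hr]. exists ((c + d) :: r).
      intros t. simpl. rewrite Hr. ring.
Qed.

Lemma peval_scal (x : R) (p : list R) :
  exists r, forall t, peval r t = x * peval p t.
Proof.
  induction p as [|c p [r Hr]].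
  - exists []. intros t; simpl; ring.
  - exists (x * c :: r). intros t. simpl. rewrite Hr. ring.
Qed.

(** Convergence modulo powers of the logarithm [T] that diverges at the end
    point [F]. *)
Definition reg_lim (F : (R -> Prop) -> Prop) (T g : R -> R) (c : R) : Prop :=
  exists p, peval p 0 = c /\
    filterlim (fun z => g z - peval p (T z)) F (locally 0).

Section Regularization.
Context {F : (R -> Prop) -> Prop} {FF : ProperFilter F} (T : R -> R).

Lemma reg_lim_of_lim (g : R -> R) (c : R) :
  filterlim g F (locally c) -> reg_lim F T g c.
Proof.
  intros Hg. exists [c]. split; [simpl; ring|].
  apply lim_cast with (c - c); [ring|]. apply lim_minus; [exact Hg|].
  apply filterlim_ext with (fun _ => c); [intros; simpl; ring|]. apply lim_const.
Qed.

Lemma reg_lim_pow (n : nat) : reg_lim F T (fun z => T z ^ S n) 0.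
Proof.
  assert (H : exists q, forall t, peval q t = t ^ n).
  { induction n as [|n [q Hq]].
    - exists [1]. intros t; simpl; ring.
    - exists (0 :: q). intros t; simpl. rewrite Hq. ring. }
  destruct H as [q Hq]. exists (0 :: q). split; [simpl; ring|].
  apply filterlim_ext with (fun _ => 0); [|apply lim_const].
  intros z. simpl. rewrite Hq. ring.
Qed.

Lemma reg_lim_add (f g : R -> R) (a b : R) :
  reg_lim F T f a -> reg_lim F T g b -> reg_lim F T (fun z => f z + g z) (a + b).
Proof.
  intros (p & <- & Hp) (q & <- & Hq). destruct (peval_add p q) as [r Hr].
  exists r. split; [apply Hr|].
  apply filterlim_ext with
    (fun z => (f z - peval p (T z)) + (g z - peval q (T z))).
  - intros z. rewrite Hr. ring.
  - apply lim_cast with (0 + 0); [ring|]. apply lim_plus; assumption.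
Qed.

Lemma reg_lim_scal (x : R) (f : R -> R) (a : R) :
  reg_lim F T f a -> reg_lim F T (fun z => x * f z) (x * a).
Proof.
  intros (p & <- & Hp). destruct (peval_scal x p) as [r Hr].
  exists r. split; [apply Hr|].
  apply filterlim_ext with (fun z => x * (f z - peval p (T z))).
  - intros z. rewrite Hr. ring.
  - apply lim_cast with (x * 0); [ring|]. apply lim_scal; assumption.
Qed.

Lemma reg_lim_ext (f g : R -> R) (a : R) :
  F (fun z => f z = g z) -> reg_lim F T f a -> reg_lim F T g a.
Proof.
  intros E (p & Hp & H). exists p. split; [exact Hp|].
  apply filterlim_ext_loc with (2 := H). revert E. apply filter_imp.
  intros z ->. reflexivity.
Qed.

Hypothesis T_infinite : filterlim (fun z => / T z) F (locally 0).
Hypothesis T_nonzero : F (fun z => T z <> 0).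

(** By induction on the degree, applied to [(p (T z) - p 0) / T z], which tends
    to 0 as soon as [p (T z)] converges. *)
Lemma peval_lim (p : list R) (l : R) :
  filterlim (fun z => peval p (T z)) F (locally l) -> forall t, peval p t = l.
Proof.
  revert l. induction p as [|c q IH]; intros l Hl t.
  - apply (lim_unique (F := F) (fun z => peval [] (T z))); [|exact Hl].
    apply lim_const.
  - assert (Hq : forall s, peval q s = 0).
    { apply IH.
      apply filterlim_ext_loc with
        (fun z => / T z * (peval (c :: q) (T z) - c)).
      - revert T_nonzero. apply filter_imp. intros z Hz. simpl. field. exact Hz.
      - apply lim_cast with (0 * (l - c)); [ring|].
        apply lim_mult; [exact T_infinite|].
        apply lim_minus; [exact Hl|apply lim_const]. }
    simpl. rewrite Hq.
    apply (lim_unique (F := F) (fun z => peval (c :: q) (T z))); [|exact Hl].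
    apply filterlim_ext with (fun _ => c + t * 0); [|apply lim_const].
    intros z. simpl. rewrite Hq. ring.
Qed.

Lemma reg_lim_unique (g : R -> R) (c l : R) :
  reg_lim F T g c -> filterlim g F (locally l) -> l = c.
Proof.
  intros (p & <- & Hp) Hg. symmetry. apply peval_lim.
  apply filterlim_ext with (fun z => g z - (g z - peval p (T z))).
  - intros z. ring.
  - apply lim_cast with (l - 0); [ring|]. apply lim_minus; assumption.
Qed.

End Regularization.

(** * Polylogarithms at 1 *)

Lemma nondecreasing_of_derive (f d : R -> R) :
  (forall z, 0 < z < 1 -> is_derive f z (d z)) ->
  (forall z, 0 < z < 1 -> 0 <= d z) ->
  forall x y, 0 < x -> x <= y -> y < 1 -> f x <= f y.
Proof.
  intros Hf Hd x y Hx Hxy Hy.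
  destruct (MVT_gen f x y d) as (c & Hc & E).
  - rewrite Rmin_left, Rmax_right by exact Hxy. intros z Hz. apply Hf. lra.
  - rewrite Rmin_left, Rmax_right by exact Hxy. intros z Hz.
    apply continuity_pt_filterlim.
    apply (ex_derive_continuous f z). exists (d z). apply Hf. lra.
  - rewrite Rmin_left, Rmax_right in Hc by exact Hxy.
    assert (Hdc := Hd c ltac:(lra)).
    assert (0 <= d c * (y - x)) by (apply Rmult_le_pos; lra). lra.
Qed.

Lemma polylog_nondecreasing (l : list nat) (x y : R) : valid l ->
  0 < x -> x <= y -> y < 1 -> polylog l x <= polylog l y.
Proof.
  intros Hv. revert x y. destruct l as [|[|[|j]] k].
  - intros; simpl; lra.
  - inversion Hv; lia.
  - inversion Hv as [|? ? _ Hk]; subst.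
    apply nondecreasing_of_derive with (fun z => polylog k z * / (1 - z)).
    + intros z Hz. apply is_derive_polylog_1; assumption.
    + intros z Hz. apply Rmult_le_pos; [apply polylog_nonneg; assumption|].
      left; apply Rinv_0_lt_compat; lra.
  - inversion Hv as [|? ? _ Hk]; subst.
    apply nondecreasing_of_derive with (fun z => polylog (S j :: k) z * / z).
    + intros z Hz. apply is_derive_polylog_SS; assumption.
    + intros z Hz. apply Rmult_le_pos.
      * apply polylog_nonneg; [apply valid_cons; [lia|exact Hk]|exact Hz].
      * left; apply Rinv_0_lt_compat; lra.
Qed.

(** As [T] is nondecreasing, [(alpha - A z) * T z], an integral of [A'] times
    the constant [T z], is at most the integral [beta - B z] of [A' * T] over
    the same interval from [z] to 1: no rate of convergence of [A] is
    needed. *)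
Lemma tail_mul_lim_1 (T A B d : R -> R) (alpha beta : R) :
  (forall x y, 0 < x -> x <= y -> y < 1 -> T x <= T y) ->
  (forall z, 0 < z < 1 -> 0 <= T z) ->
  (forall z, 0 < z < 1 -> 0 <= d z) ->
  (forall z, 0 < z < 1 -> is_derive A z (d z)) ->
  (forall z, 0 < z < 1 -> is_derive B z (T z * d z)) ->
  filterlim A (at_left 1) (locally alpha) ->
  filterlim B (at_left 1) (locally beta) ->
  filterlim (fun z => T z * (A z - alpha)) (at_left 1) (locally 0).
Proof.
  intros HT HT0 Hd HA HB LA LB.
  assert (Hnear : forall z, 0 < z < 1 -> at_left 1 (fun y => z < y < 1)).
  { intros z Hz. assert (Hp : 0 < 1 - z) by lra.
    exists (mkposreal _ Hp). intros y Hy Hy1.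
    unfold ball in Hy; simpl in Hy; unfold AbsRing_ball, abs, minus, plus, opp in Hy;
      simpl in Hy.
    apply Rabs_def2 in Hy. lra. }
  apply lim_0_squeeze with (fun z => beta - B z).
  - generalize near_1. apply filter_imp. intros z Hz.
    assert (H1 : A z <= alpha).
    { apply (lim_le (F := at_left 1) (fun _ => A z) A); [|apply lim_const|exact LA].
      generalize (Hnear z Hz). apply filter_imp. intros y Hy.
      apply (nondecreasing_of_derive A d); try assumption; lra. }
    assert (H2 : T z * (alpha - A z) <= beta - B z).
    { apply (lim_le (F := at_left 1) (fun y => T z * (A y - A z)) (fun y => B y - B z)).
      - generalize (Hnear z Hz). apply filter_imp. intros y Hy.
        destruct (MVT_gen (fun x => B x - T z * A x) z y
                    (fun x => T x * d x - T z * d x)) as (c & Hc & E).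
        + rewrite Rmin_left, Rmax_right by lra. intros x Hx.
          apply (is_derive_minus B (fun x => T z * A x)); [apply HB; lra|].
          apply is_derive_cmul, HA. lra.
        + rewrite Rmin_left, Rmax_right by lra. intros x Hx.
          apply continuity_pt_filterlim.
          apply (ex_derive_continuous (fun x => B x - T z * A x) x).
          exists (T x * d x - T z * d x).
          apply (is_derive_minus B (fun x => T z * A x)); [apply HB; lra|].
          apply is_derive_cmul, HA. lra.
        + rewrite Rmin_left, Rmax_right in Hc by lra.
          assert (HTc := HT z c ltac:(lra) ltac:(lra) ltac:(lra)).
          assert (Hdc := Hd c ltac:(lra)).
          assert (0 <= (T c - T z) * d c * (y - z)).
          { repeat apply Rmult_le_pos; lra. }
          lra.
      - apply lim_scal, lim_minus; [exact LA|apply lim_const].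
      - apply lim_minus; [exact LB|apply lim_const]. }
    assert (H0 := HT0 z Hz).
    rewrite Rabs_left1; [lra|].
    assert (0 <= T z * (alpha - A z)) by (apply Rmult_le_pos; lra). lra.
  - apply lim_cast with (beta - beta); [ring|].
    apply lim_minus; [apply lim_const|exact LB].
Qed.

Lemma is_derive_ln' (z : R) : 0 < z < 1 -> is_derive ln z (/ z).
Proof. intros Hz. apply is_derive_ln. lra. Qed.

Lemma ln_lim_1 : filterlim ln (at_left 1) (locally 0).
Proof.
  rewrite <- ln_1.
  apply (filterlim_filter_le_1 (F := locally 1) ln); [apply filter_le_within|].
  apply (ex_derive_continuous ln 1). exists (/ 1). apply is_derive_ln. lra.
Qed.

(** [tail_mul_lim_1] for [A = ln]: a primitive of [polylog l z * / z] is again a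
    polylogarithm, convergent at 1, or [ln] itself for empty [l]. *)
Lemma polylog_ln_pow_lim_1 (l : list nat) (i : nat) : valid l ->
  filterlim (fun z => polylog l z * ln z ^ S i) (at_left 1) (locally 0).
Proof.
  intros Hl.
  assert (H : filterlim (fun z => polylog l z * (ln z - 0)) (at_left 1) (locally 0)).
  { assert (HB : exists B beta,
              (forall z, 0 < z < 1 -> is_derive B z (polylog l z * / z)) /\
              filterlim B (at_left 1) (locally beta)).
    { destruct l as [|[|j] k].
      - exists ln, 0. split; [|exact ln_lim_1]. intros z Hz.
        simpl. rewrite Rmult_1_l. apply is_derive_ln', Hz.
      - inversion Hl; lia.
      - inversion Hl as [|? ? _ Hk]; subst.
        exists (polylog (S (S j) :: k)), (mzv_desc (S (S j) :: k)).
        split; [|apply polylog_lim_1, Hk].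
        intros z Hz. apply is_derive_polylog_SS; assumption. }
    destruct HB as (B & beta & HB & LB).
    apply tail_mul_lim_1 with (B := B) (d := Rinv) (beta := beta).
    - intros x y. apply polylog_nondecreasing, Hl.
    - intros z. apply polylog_nonneg, Hl.
    - intros z Hz. left; apply Rinv_0_lt_compat; lra.
    - exact is_derive_ln'.
    - exact HB.
    - exact ln_lim_1.
    - exact LB. }
  induction i as [|i IH].
  - apply filterlim_ext with (2 := H). intros z. simpl. ring.
  - apply filterlim_ext with (fun z => ln z * (polylog l z * ln z ^ S i)).
    + intros z. simpl. ring.
    + apply lim_cast with (0 * 0); [ring|]. apply lim_mult; [exact ln_lim_1|exact IH].
Qed.

Definition Li1 : R -> R := polylog [1%nat].

Lemma valid_1 : valid [1%nat].
Proof. repeat constructor. Qed.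

Lemma is_derive_Li1 (z : R) : 0 < z < 1 -> is_derive Li1 z (/ (1 - z)).
Proof.
  intros Hz. apply is_derive_cast with (polylog [] z * / (1 - z)); [simpl; ring|].
  apply is_derive_polylog_1; [constructor|exact Hz].
Qed.

Lemma Li1_ln (z : R) : 0 < z < 1 -> Li1 z = - ln (1 - z).
Proof.
  revert z. apply same_derive_lim_0 with (fun z => / (1 - z)).
  - exact is_derive_Li1.
  - intros z Hz. auto_derive; [lra|]. field. lra.
  - apply polylog_lim_0, valid_1.
  - apply (filterlim_filter_le_1 (F := locally 0) (fun z => - ln (1 - z)));
      [apply filter_le_within|].
    apply lim_cast with (- ln (1 - 0)); [rewrite Rminus_0_r, ln_1; ring|].
    apply (ex_derive_continuous (fun z => - ln (1 - z)) 0).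
    auto_derive. lra.
Qed.

Lemma compl_at_left_1 : filterlim (fun z => 1 - z) (at_left 1) (at_right 0).
Proof.
  intros P [eps H]. exists eps. intros y Hy Hy1. apply H; [|lra].
  unfold ball in *; simpl in *; unfold AbsRing_ball, abs, minus, plus, opp in *;
    simpl in *.
  rewrite <- Rabs_Ropp. replace (- (1 - y + - 0)) with (y + - 1) by ring. exact Hy.
Qed.

Lemma inv_Li1_lim_1 : filterlim (fun z => / Li1 z) (at_left 1) (locally 0).
Proof.
  apply filterlim_ext_loc with (fun z => -1 * / ln (1 - z)).
  - generalize near_1. apply filter_imp. intros z Hz. rewrite (Li1_ln z Hz).
    assert (H := ln_neg (1 - z) ltac:(lra)). field. lra.
  - apply lim_cast with (-1 * 0); [ring|]. apply lim_scal.
    apply (filterlim_comp _ _ _ (fun z => 1 - z) (fun z => / ln z) _ (at_right 0)).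
    + exact compl_at_left_1.
    + exact inv_ln_lim_0.
Qed.

Lemma Li1_nonzero_near_1 : at_left 1 (fun z => Li1 z <> 0).
Proof.
  generalize near_1. apply filter_imp. intros z Hz. rewrite (Li1_ln z Hz).
  assert (H := ln_neg (1 - z) ltac:(lra)). lra.
Qed.

Lemma Li1_span : span rational polylogs Li1.
Proof. apply span_base. exists 1%nat, []. split; [exact valid_1|reflexivity]. Qed.

Lemma Li1_pow_mul (n : nat) (f : R -> R) :
  span rational polylogs f -> span rational polylogs (fun z => Li1 z ^ n * f z).
Proof.
  intros Hf. induction n as [|n IH].
  - apply span_ext with (2 := Hf). intros; simpl; ring.
  - apply span_ext with (2 := polylogs_mul _ _ Li1_span IH). intros; simpl; ring.
Qed.

(** Polynomials in the divergent function [Li1] whose coefficients converge at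
    1. Leaving out the constant 1 puts the limit of the coefficient of [Li1^0]
    in [mzv_span]. *)
Inductive Li1_expansion : (R -> R) -> Prop :=
  | Li1_expansion_pow (n : nat) : Li1_expansion (fun z => Li1 z ^ S n)
  | Li1_expansion_adm (n j : nat) (k : list nat) : valid k ->
      Li1_expansion (fun z => Li1 z ^ n * polylog (S (S j) :: k) z).

Lemma adm_Li1_expansion (f : R -> R) :
  span rational adm_polylogs f -> span rational Li1_expansion f.
Proof.
  apply span_mono; [auto|]. intros g (j & k & Hk & ->).
  apply span_ext with (2 := span_base _ _ _ (Li1_expansion_adm 0 j k Hk)).
  intros; simpl; ring.
Qed.

(** Integration by parts lowers [Li1^n * polylog m] dz/(1-z), with [m]
    admissible, to [Li1^(n+1) * polylog m'] dz/z, and the product is a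
    combination of polylogarithms. *)
Lemma Li1_expansion_primitive (f : R -> R) :
  span rational Li1_expansion f ->
  exists G, span rational Li1_expansion G /\
    primitive0 (fun z => / (1 - z)) f G.
Proof.
  apply span_primitive0. intros g Hg.
  assert (L0 : filterlim Li1 (at_right 0) (locally 0)).
  { apply polylog_lim_0, valid_1. }
  assert (Lp : forall n, filterlim (fun z => Li1 z ^ S n) (at_right 0) (locally 0)).
  { intros n. induction n as [|n IH].
    - apply filterlim_ext with (2 := L0). intros; simpl; ring.
    - apply lim_cast with (0 * 0); [ring|]. apply (lim_mult Li1); assumption. }
  destruct Hg as [n|n j k Hk].
  - exists (fun z => / INR (S (S n)) * Li1 z ^ S (S n)). split; [|split].
    + apply span_scal; [apply rational_inv_INR|]. apply span_base. constructor.
    + intros z Hz.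
      apply is_derive_cast with
        (2 := is_derive_cmul _ _ _ _ (is_derive_powR _ (S n) _ _ (is_derive_Li1 z Hz))).
      field. repeat split; try lra. apply not_0_INR; lia.
    + apply lim_cast with (/ INR (S (S n)) * 0); [ring|]. apply lim_scal, Lp.
  - set (m := S (S j) :: k).
    assert (Hm : valid m) by (apply valid_cons; [lia|exact Hk]).
    destruct (primitive_dz_over_z (fun z => Li1 z ^ S n * polylog (S j :: k) z))
      as (B & SB & HB & LB).
    { apply Li1_pow_mul, span_base. exists (S j), k. split; [|reflexivity].
      apply valid_cons; [lia|exact Hk]. }
    exists (fun z => / INR (S n) * (Li1 z ^ S n * polylog m z + -1 * B z)).
    split; [|split].
    + apply span_scal; [apply rational_inv_INR|]. apply span_add.
      * apply span_base. constructor; exact Hk.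
      * apply span_scal; [apply rational_opp, rational_1|].
        apply adm_Li1_expansion, SB.
    + intros z Hz.
      eapply is_derive_cast; [|apply is_derive_cmul, is_derive_add;
        [apply is_derive_mul; [apply is_derive_powR, is_derive_Li1, Hz
                              |apply is_derive_polylog_SS; assumption]
        |apply is_derive_cmul, HB, Hz]].
      cbv beta. fold m. field. repeat split; try lra. apply not_0_INR; lia.
    + apply lim_cast with (/ INR (S n) * (0 * 0 + -1 * 0)); [ring|].
      apply (lim_scal _ (fun z => Li1 z ^ S n * polylog m z + -1 * B z)).
      apply (lim_plus (fun z => Li1 z ^ S n * polylog m z)).
      * apply lim_mult; [apply Lp|apply polylog_lim_0, Hm].
      * apply lim_scal, LB.
Qed.

(** Leading exponents at least 2 are admissible; for the others
    [Li1_expansion_primitive] performs the last integration, against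
    dz/(1-z). *)
Lemma polylog_Li1_expansion (j : nat) (k : list nat) : valid (j :: k) ->
  span rational Li1_expansion (polylog (j :: k)).
Proof.
  revert j. induction k as [|i k IH]; intros j Hv; inversion Hv as [|? ? Hj Hk]; subst;
    destruct j as [|[|j]]; try lia.
  - apply span_ext with (2 := span_base _ _ _ (Li1_expansion_pow 0)).
    intros z Hz. unfold Li1. ring.
  - apply adm_Li1_expansion, span_base. exists j, []. auto.
  - destruct (Li1_expansion_primitive _ (IH i Hk)) as (G & SG & HG & LG).
    apply span_ext with (2 := SG).
    apply same_derive_lim_0 with (fun z => polylog (i :: k) z * / (1 - z)).
    + exact HG.
    + intros z Hz. apply is_derive_polylog_1; assumption.
    + exact LG.
    + apply polylog_lim_0, Hv.
  - apply adm_Li1_expansion, span_base. exists j, (i :: k). auto.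
Qed.

Lemma Li1_expansion_reg_lim (f : R -> R) :
  Li1_expansion f -> exists c, mzv_span c /\ reg_lim (at_left 1) Li1 f c.
Proof.
  intros [n|[|n] j k Hk].
  - exists 0. split; [apply mzv_span_0|apply reg_lim_pow].
  - eexists. split; [apply (mzv_span_desc j k Hk)|]. apply reg_lim_of_lim.
    apply filterlim_ext with (polylog (S (S j) :: k)); [intros; simpl; ring|].
    apply polylog_lim_1, Hk.
  -
    (* Up to o(1), replace the polylogarithm by its value at 1. *)
    set (alpha := mzv_desc (S (S j) :: k)).
    exists (0 + alpha * 0). split; [replace (0 + alpha * 0) with 0 by ring; apply mzv_span_0|].
    apply reg_lim_ext with
      (fun z => Li1 z ^ S n * (polylog (S (S j) :: k) z - alpha) + alpha * Li1 z ^ S n).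
    { apply filter_forall. intros z. ring. }
    apply reg_lim_add; [apply reg_lim_of_lim|apply reg_lim_scal, reg_lim_pow].
    assert (Hv : valid (S j :: k)) by (apply valid_cons; [lia|exact Hk]).
    destruct (primitive_dz_over_z (fun z => Li1 z ^ S n * polylog (S j :: k) z))
      as (B & SB & HB & LB).
    { apply Li1_pow_mul, span_base. exists (S j), k. auto. }
    destruct (adm_lim_1 B SB) as (beta & _ & LB1).
    apply tail_mul_lim_1 with (B := B) (beta := beta)
      (d := fun z => polylog (S j :: k) z * / z).
    + intros x y Hx Hxy Hy. apply pow_incr. split.
      * apply polylog_nonneg; [exact valid_1|lra].
      * apply polylog_nondecreasing; [exact valid_1|assumption..].
    + intros z Hz. apply pow_le, polylog_nonneg; [exact valid_1|exact Hz].
    + intros z Hz. apply Rmult_le_pos; [apply polylog_nonneg; assumption|].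
      left; apply Rinv_0_lt_compat; lra.
    + intros z Hz. apply is_derive_polylog_SS; assumption.
    + intros z Hz. apply is_derive_cast with (2 := HB z Hz). ring.
    + apply polylog_lim_1, Hk.
    + exact LB1.
Qed.

Lemma polylog_reg_lim_1 (j : nat) (k : list nat) : valid (j :: k) ->
  exists c, mzv_span c /\ reg_lim (at_left 1) Li1 (polylog (j :: k)) c.
Proof.
  intros Hv.
  induction (polylog_Li1_expansion j k Hv)
    as [|f Hf|f g _ [a [Ha Lf]] _ [b [Hb Lg]]|c f Hc _ [a [Ha Lf]]|f g E _ [a [Ha Lf]]].
  - exists 0. split; [apply mzv_span_0|]. apply reg_lim_of_lim, lim_const.
  - apply Li1_expansion_reg_lim, Hf.
  - exists (a + b). split; [apply mzv_span_add|apply reg_lim_add]; assumption.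
  - exists (c * a). split; [apply mzv_span_scal|apply reg_lim_scal]; assumption.
  - exists a. split; [exact Ha|].
    apply reg_lim_ext with (2 := Lf). generalize near_1. apply filter_imp, E.
Qed.

(** * Polynomials in log z and polylogarithms *)

Inductive log_monomial (P : R -> Prop) : (R -> R) -> Prop :=
  | monomial_const (c : R) : P c -> log_monomial P (fun _ => c)
  | monomial_ln (i : nat) : log_monomial P (fun z => ln z ^ S i)
  | monomial_polylog (j : nat) (k : list nat) (i : nat) : valid (j :: k) ->
      log_monomial P (fun z => polylog (j :: k) z * ln z ^ i).

(** For [P = mzv_ring] this turns out to be an algebra that contains [Plog]
    and is closed under integration against both forms; for [P = mzv_span] it
    is the ideal of those functions in it whose constant term involves no
    rational number, and all integrals land there. *)
Definition log_span (P : R -> Prop) : (R -> R) -> Prop :=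
  span mzv_ring (log_monomial P).

Lemma log_span_mono (P P' : R -> Prop) (f : R -> R) :
  (forall c, P c -> P' c) -> log_span P f -> log_span P' f.
Proof.
  intros H. apply span_mono; [auto|]. intros g Hg. apply span_base.
  destruct Hg; constructor; auto.
Qed.

Lemma log_span_const (P : R -> Prop) (c : R) : P c -> log_span P (fun _ => c).
Proof. intros Hc. apply span_base. constructor; exact Hc. Qed.

Lemma log_span_rational_scal (P : R -> Prop) (c : R) (f : R -> R) :
  rational c -> log_span P f -> log_span P (fun z => c * f z).
Proof. intros Hc. apply span_scal, mzv_ring_rational, Hc. Qed.

Lemma log_span_opp (P : R -> Prop) (f : R -> R) :
  log_span P f -> log_span P (fun z => - f z).
Proof.
  intros Hf. apply span_ext with (fun z => -1 * f z); [intros; ring|].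
  apply log_span_rational_scal; [apply rational_opp, rational_1|exact Hf].
Qed.

Lemma log_span_polylogs_ln (P : R -> Prop) (f : R -> R) (i : nat) :
  span rational polylogs f -> log_span P (fun z => f z * ln z ^ i).
Proof.
  intros Hf.
  induction Hf as [|f (j & k & Hv & ->)|f g _ IHf _ IHg|c f Hc _ IH|f g E _ IH].
  - apply span_ext with (fun _ => 0); [intros; ring|constructor].
  - apply span_base. constructor; exact Hv.
  - apply span_ext with (2 := span_add _ _ _ _ IHf IHg). intros; ring.
  - apply span_ext with (2 := log_span_rational_scal _ _ _ Hc IH). intros; ring.
  - apply span_ext with (2 := IH). intros z Hz. rewrite (E z Hz). reflexivity.
Qed.

Lemma log_span_mul (P : R -> Prop) (f g : R -> R) : mzv_ideal P ->
  log_span mzv_ring f -> log_span P g -> log_span P (fun z => f z * g z).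
Proof.
  intros (_ & _ & HP & _ & HR). apply span_mul. intros u v Hu Hv.
  destruct Hu as [c Hc|i|j k i Hk].
  - destruct Hv as [d Hd|i|j k i Hk].
    + apply log_span_const, HP; assumption.
    + apply span_scal; [exact Hc|]. apply span_base. constructor.
    + apply (span_scal _ _ c); [exact Hc|]. apply span_base. constructor; exact Hk.
  - destruct Hv as [d Hd|m|j k m Hk].
    + apply span_ext with (fun z => d * ln z ^ S i); [intros; ring|].
      apply span_scal; [apply HR, Hd|]. apply span_base. constructor.
    + apply span_ext with (fun z => ln z ^ S (i + S m)).
      * intros z _. change (S (i + S m)) with (S i + S m)%nat. apply pow_add.
      * apply span_base. constructor.
    + apply span_ext with (fun z => polylog (j :: k) z * ln z ^ (S i + m)).
      * intros z _. rewrite pow_add. ring.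
      * apply span_base. constructor; exact Hk.
  - destruct Hv as [d Hd|m|j' k' m Hk'].
    + apply span_ext with (fun z => d * (polylog (j :: k) z * ln z ^ i)); [intros; ring|].
      apply span_scal; [apply HR, Hd|]. apply span_base. constructor; exact Hk.
    + apply span_ext with (fun z => polylog (j :: k) z * ln z ^ (i + S m)).
      * intros z _. rewrite pow_add. ring.
      * apply span_base. constructor; exact Hk.
    + apply span_ext with
        (fun z => (polylog (j :: k) z * polylog (j' :: k') z) * ln z ^ (i + m)).
      * intros z _. rewrite pow_add. ring.
      * apply log_span_polylogs_ln, polylogs_mul; apply span_base.
        -- exists j, k. auto.
        -- exists j', k'. auto.
Qed.

(** Integration by parts in the power of the logarithm. *)
Lemma polylog_ln_primitive_z (P : R -> Prop) (i j : nat) (k : list nat) :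
  valid (j :: k) ->
  exists G, log_span P G /\
    primitive Rinv (fun z => polylog (j :: k) z * ln z ^ i) G.
Proof.
  revert j. induction i as [|i IH]; intros j Hv; inversion Hv as [|? ? Hj Hk]; subst;
    (destruct j as [|j]; [lia|]).
  - exists (fun z => polylog (S (S j) :: k) z * ln z ^ 0). split.
    + apply span_base. constructor. apply valid_cons; [lia|exact Hk].
    + intros z Hz.
      apply is_derive_ext with (polylog (S (S j) :: k)); [intros; simpl; ring|].
      apply is_derive_cast with (2 := is_derive_polylog_SS j k z Hk Hz). simpl. ring.
  - assert (Hv' : valid (S (S j) :: k)) by (apply valid_cons; [lia|exact Hk]).
    destruct (IH (S (S j)) Hv') as (G & SG & HG).
    exists (fun z => polylog (S (S j) :: k) z * ln z ^ S i + - INR (S i) * G z). split.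
    + apply span_add.
      * apply span_base. constructor; exact Hv'.
      * apply log_span_rational_scal; [apply rational_opp, rational_INR|exact SG].
    + intros z Hz.
      eapply is_derive_cast; [|apply is_derive_add;
        [apply is_derive_mul; [apply is_derive_polylog_SS; assumption
                              |apply is_derive_powR, is_derive_ln', Hz]
        |apply is_derive_cmul, HG, Hz]].
      cbv beta. field. lra.
Qed.

Lemma polylog_ln_primitive_1mz (P : R -> Prop) (l : list nat) (i : nat) :
  valid l ->
  exists G, log_span P G /\
    primitive (fun z => / (1 - z)) (fun z => polylog l z * ln z ^ i) G.
Proof.
  intros Hv.
  assert (Hv' : valid (1%nat :: l)) by (apply valid_cons; [lia|exact Hv]).
  destruct i as [|i].
  - exists (fun z => polylog (1%nat :: l) z * ln z ^ 0). split.
    + apply span_base. constructor. exact Hv'.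
    + intros z Hz.
      apply is_derive_ext with (polylog (1%nat :: l)); [intros; simpl; ring|].
      apply is_derive_cast with (2 := is_derive_polylog_1 l z Hv Hz). simpl. ring.
  - destruct (polylog_ln_primitive_z P i 1 l Hv') as (G & SG & HG).
    exists (fun z => polylog (1%nat :: l) z * ln z ^ S i + - INR (S i) * G z). split.
    + apply span_add.
      * apply span_base. constructor; exact Hv'.
      * apply log_span_rational_scal; [apply rational_opp, rational_INR|exact SG].
    + intros z Hz.
      eapply is_derive_cast; [|apply is_derive_add;
        [apply is_derive_mul; [apply is_derive_polylog_1; assumption
                              |apply is_derive_powR, is_derive_ln', Hz]
        |apply is_derive_cmul, HG, Hz]].
      cbv beta. field. lra.
Qed.

Lemma ln_pow_primitive_z (P : R -> Prop) (i : nat) :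
  exists G, log_span P G /\ primitive Rinv (fun z => ln z ^ i) G.
Proof.
  exists (fun z => / INR (S i) * ln z ^ S i). split.
  - apply log_span_rational_scal; [apply rational_inv_INR|].
    apply span_base. constructor.
  - intros z Hz.
    apply is_derive_cast with
      (2 := is_derive_cmul _ _ _ _ (is_derive_powR _ i _ _ (is_derive_ln' z Hz))).
    field. repeat split; try lra. apply not_0_INR; lia.
Qed.

Lemma log_span_primitive (w : form) (f : R -> R) : log_span mzv_ring f ->
  exists G, log_span mzv_span G /\ primitive (density w) f G.
Proof.
  apply span_primitive. intros g Hg.
  assert (Hc : forall h c, mzv_ring c ->
            (exists G, log_span mzv_span G /\ primitive (density w) h G) ->
            exists G, log_span mzv_span G /\
              primitive (density w) (fun z => c * h z) G).
  { intros h c Hc (G & SG & HG). exists (fun z => c * G z).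
    split; [apply span_scal; assumption|apply primitive_scal, HG]. }
  assert (He : forall h h', (forall z, h z = h' z) ->
            (exists G, log_span mzv_span G /\ primitive (density w) h G) ->
            exists G, log_span mzv_span G /\ primitive (density w) h' G).
  { intros h h' E (G & SG & HG). exists G. split; [exact SG|].
    apply primitive_ext with (2 := HG). auto. }
  assert (Hln : forall i, exists G, log_span mzv_span G /\
                  primitive (density w) (fun z => ln z ^ i) G).
  { intros i. destruct w.
    - apply ln_pow_primitive_z.
    - apply He with (fun z => polylog [] z * ln z ^ i); [intros; simpl; ring|].
      apply polylog_ln_primitive_1mz. constructor. }
  destruct Hg as [c Hcc|i|j k i Hk].
  - apply He with (fun z => c * ln z ^ 0); [intros; simpl; ring|]. apply Hc; auto.
  - apply Hln.
  - destruct w; [apply polylog_ln_primitive_z|apply polylog_ln_primitive_1mz]; exact Hk.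
Qed.

Lemma log_span_continuous (P : R -> Prop) (f : R -> R) : log_span P f ->
  forall z, 0 < z < 1 -> continuous f z.
Proof.
  intros Hf z Hz. induction Hf as [|f Hf|f g _ IHf _ IHg|c f _ _ IH|f g E _ IH].
  - apply continuous_const.
  - assert (Hln : forall i, continuous (fun t => ln t ^ i) z).
    { intros [|i]; [apply continuous_const|].
      apply (ex_derive_continuous (fun t => ln t ^ S i) z).
      eexists. apply is_derive_powR, is_derive_ln', Hz. }
    destruct Hf as [c _|i|j k i Hk]; [apply continuous_const|apply Hln|].
    apply (continuous_mult (polylog (j :: k)) (fun t => ln t ^ i)); [|apply Hln].
    apply (ex_derive_continuous (polylog (j :: k)) z).
    eexists. apply is_derive_polylog_PSeries; assumption.
  - exact (continuous_plus f g z IHf IHg).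
  - exact (continuous_scal_r c f z IH).
  - apply continuous_ext_loc with (2 := IH).
    apply locally_interval with (a := 0) (b := 1); simpl; try apply Hz.
    intros y H0 H1. apply E. auto.
Qed.

(** * Regularized values at both ends *)

Lemma log_span_reg_lim (P : R -> Prop) (F : (R -> Prop) -> Prop)
    (FF : ProperFilter F) (T f : R -> R) :
  mzv_ideal P -> F (fun z => 0 < z < 1) ->
  (forall g, log_monomial P g -> exists c, P c /\ reg_lim F T g c) ->
  log_span P f -> exists c, P c /\ reg_lim F T f c.
Proof.
  intros (H0 & Hadd & Hmul & _ & _) Hnear HB Hf.
  induction Hf as [|f Hf|f g _ [a [Ha Lf]] _ [b [Hb Lg]]|c f Hc _ [a [Ha Lf]]
                  |f g E _ [a [Ha Lf]]].
  - exists 0. split; [exact H0|]. apply reg_lim_of_lim, lim_const.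
  - apply HB, Hf.
  - exists (a + b). split; [apply Hadd|apply reg_lim_add]; assumption.
  - exists (c * a). split; [apply Hmul|apply reg_lim_scal]; assumption.
  - exists a. split; [exact Ha|].
    apply reg_lim_ext with (2 := Lf). revert Hnear. apply filter_imp, E.
Qed.

Lemma log_span_reg_lim_0 (P : R -> Prop) (f : R -> R) : mzv_ideal P ->
  log_span P f -> exists c, P c /\ reg_lim (at_right 0) ln f c.
Proof.
  intros HP. apply log_span_reg_lim; [apply at_right_proper_filter|exact HP|exact near_0|].
  destruct HP as (H0 & _). intros g [c Hc|i|j k i Hk].
  - exists c. split; [exact Hc|]. apply reg_lim_of_lim, lim_const.
  - exists 0. split; [exact H0|apply reg_lim_pow].
  - exists 0. split; [exact H0|]. apply reg_lim_of_lim, polylog_ln_pow_lim_0, Hk.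
Qed.

Lemma log_span_reg_lim_1 (P : R -> Prop) (f : R -> R) : mzv_ideal P ->
  log_span P f -> exists c, P c /\ reg_lim (at_left 1) Li1 f c.
Proof.
  intros HP. apply log_span_reg_lim; [apply at_left_proper_filter|exact HP|exact near_1|].
  destruct HP as (H0 & _ & _ & HS & _). intros g [c Hc|i|j k [|i] Hk].
  - exists c. split; [exact Hc|]. apply reg_lim_of_lim, lim_const.
  - exists 0. split; [exact H0|]. apply reg_lim_of_lim.
    apply filterlim_ext with (fun z => polylog [] z * ln z ^ S i); [intros; simpl; ring|].
    apply polylog_ln_pow_lim_1. constructor.
  - destruct (polylog_reg_lim_1 j k Hk) as (c & Hc & Hr).
    exists c. split; [apply HS, Hc|].
    apply reg_lim_ext with (2 := Hr). apply filter_forall. intros z. simpl. ring.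
  - exists 0. split; [exact H0|]. apply reg_lim_of_lim, polylog_ln_pow_lim_1, Hk.
Qed.

(** * The functions of the theorem *)

(** By induction, [polylog l (1 - z)] is minus a primitive of a known
    function, up to a constant. It vanishes at 1, so the constant is the
    regularized limit at 1 of that primitive. *)
Lemma polylog_compl_step (l : list nat) (j : nat) (k : list nat) (w : form) :
  valid (j :: k) ->
  (forall z, 0 < z < 1 ->
     is_derive (polylog (j :: k)) z (polylog l z * density w (1 - z))) ->
  log_span mzv_ring (fun z => polylog l (1 - z)) ->
  log_span mzv_ring (fun z => polylog (j :: k) (1 - z)).
Proof.
  intros Hv Hd IH.
  destruct (log_span_primitive w _ IH) as (G & SG & HG).
  destruct (log_span_reg_lim_1 _ _ mzv_ideal_span SG) as (c & Hc & Hr).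
  set (f := fun z => polylog (j :: k) (1 - z)).
  assert (Hf : forall z, 0 < z < 1 ->
            is_derive f z (- (polylog l (1 - z) * density w z))).
  { intros z Hz.
    apply is_derive_cast with
      (scal (-1) (polylog l (1 - z) * density w (1 - (1 - z)))).
    { replace (1 - (1 - z)) with z by ring.
      unfold scal; simpl; unfold mult; simpl. ring. }
    apply (is_derive_comp (polylog (j :: k)) (fun z => 1 - z)).
    - apply Hd. lra.
    - auto_derive; [exact I|ring]. }
  assert (Hconst : forall z, 0 < z < 1 -> f z + G z = f (/ 2) + G (/ 2)).
  { intros z Hz. apply (derive_0_const (fun t => f t + G t)); [|exact Hz|lra].
    intros t Ht. eapply is_derive_cast; [|apply is_derive_add;
      [apply Hf, Ht|apply HG, Ht]]. ring. }
  assert (Lf : filterlim f (at_left 1) (locally 0)).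
  { apply (filterlim_comp _ _ _ (fun z => 1 - z) (polylog (j :: k)) _ (at_right 0)).
    - exact compl_at_left_1.
    - apply polylog_lim_0, Hv. }
  assert (LG : filterlim G (at_left 1) (locally (f (/ 2) + G (/ 2)))).
  { apply filterlim_ext_loc with (fun z => (f (/ 2) + G (/ 2)) - f z).
    - generalize near_1. apply filter_imp. intros z Hz.
      generalize (Hconst z Hz). lra.
    - apply lim_cast with (f (/ 2) + G (/ 2) - 0); [ring|].
      apply lim_minus; [apply lim_const|exact Lf]. }
  assert (E := reg_lim_unique Li1 inv_Li1_lim_1 Li1_nonzero_near_1 G c _ Hr LG).
  apply span_ext with (fun z => c + - G z).
  - intros z Hz. generalize (Hconst z Hz). fold (f z). lra.
  - apply span_add; [apply log_span_const, mzv_ring_span, Hc|].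
    apply log_span_opp, (log_span_mono mzv_span); [exact mzv_ring_span|exact SG].
Qed.

Lemma polylog_compl_log_span (l : list nat) : valid l ->
  log_span mzv_ring (fun z => polylog l (1 - z)).
Proof.
  induction 1 as [|j k Hj Hk IHk].
  - apply (log_span_const _ 1), mzv_ring_rational, rational_1.
  - destruct j as [|j]; [lia|]. clear Hj. induction j as [|j IHj].
    + apply polylog_compl_step with (3 := IHk) (w := dz_over_z).
      * apply valid_cons; [lia|exact Hk].
      * intros z Hz. apply is_derive_polylog_1; assumption.
    + apply polylog_compl_step with (3 := IHj) (w := dz_over_1mz).
      * apply valid_cons; [lia|exact Hk].
      * intros z Hz. simpl density. replace (1 - (1 - z)) with z by ring.
        apply is_derive_polylog_SS; assumption.
Qed.

Lemma polylog_log_span (l : list nat) : valid l -> log_span mzv_ring (polylog l).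
Proof.
  intros Hl. destruct l as [|j k].
  - apply (log_span_const _ 1), mzv_ring_rational, rational_1.
  - apply span_ext with (fun z => polylog (j :: k) z * ln z ^ 0).
    + intros z _. simpl. ring.
    + apply span_base. constructor; exact Hl.
Qed.

Lemma Plog_log_span (f : R -> R) : Plog f -> log_span mzv_ring f.
Proof.
  induction 1 as [|k [_ Hk]|k [_ Hk]|q f _ IH|f g _ IHf _ IHg|f g _ IHf _ IHg|f g E _ IH].
  - apply log_span_const, mzv_ring_rational, rational_1.
  - apply (polylog_log_span (rev k)), Forall_rev, Hk.
  - apply (polylog_compl_log_span (rev k)), Forall_rev, Hk.
  - apply log_span_rational_scal; [apply rational_Q2R|exact IH].
  - apply span_add; assumption.
  - apply log_span_mul; [exact mzv_ideal_ring|assumption..].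
  - apply span_ext with (2 := IH). exact E.
Qed.

(** * The iterated integral *)

(** The lower end point stays a variable until all integrations are done.
    In this tensor form an integration over the second variable treats the
    factor [c a] as a constant, and the limit [a -> 0+] concerns the factors
    [c] alone. *)
Inductive log_tensor (P : R -> Prop) : (R -> R -> R) -> Prop :=
  | tensor_l (c g : R -> R) : log_span P c -> log_span mzv_ring g ->
      log_tensor P (fun a b => c a * g b)
  | tensor_r (c g : R -> R) : log_span mzv_ring c -> log_span P g ->
      log_tensor P (fun a b => c a * g b)
  | tensor_add (h h' : R -> R -> R) : log_tensor P h -> log_tensor P h' ->
      log_tensor P (fun a b => h a b + h' a b)
  | tensor_ext (h h' : R -> R -> R) :
      (forall a b, 0 < a < 1 -> 0 < b < 1 -> h a b = h' a b) ->
      log_tensor P h -> log_tensor P h'.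

Lemma is_RInt_primitive (w : form) (f G : R -> R) (a b : R) :
  log_span mzv_ring f -> primitive (density w) f G ->
  0 < a < 1 -> 0 < b < 1 ->
  is_RInt (fun z => f z * density w z) a b (G b - G a).
Proof.
  intros Hf HG Ha Hb.
  assert (Hab : forall z, Rmin a b <= z <= Rmax a b -> 0 < z < 1).
  { intros z Hz. unfold Rmin, Rmax in Hz. destruct (Rle_dec a b); lra. }
  apply (is_RInt_derive G (fun z => f z * density w z)).
  - intros z Hz. apply HG, Hab, Hz.
  - intros z Hz. apply Hab in Hz.
    apply (continuous_mult f (density w)).
    + exact (log_span_continuous _ f Hf z Hz).
    + apply (ex_derive_continuous (density w) z).
      destruct w; unfold density; auto_derive; lra.
Qed.

Lemma log_tensor_integral (f : R -> R) (w : form) (h : R -> R -> R) :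
  log_span mzv_ring f -> log_tensor mzv_ring h ->
  exists H, log_tensor mzv_span H /\
    forall a b, 0 < a < 1 -> 0 < b < 1 ->
      is_RInt (fun z => h a z * (f z * density w z)) a b (H a b).
Proof.
  intros Hf Hh.
  assert (Hbase : forall c g, log_span mzv_ring c -> log_span mzv_ring g ->
    exists H, log_tensor mzv_span H /\
      forall a b, 0 < a < 1 -> 0 < b < 1 ->
        is_RInt (fun z => (c a * g z) * (f z * density w z)) a b (H a b)).
  { intros c g Hc Hg.
    assert (Hgf := log_span_mul _ g f mzv_ideal_ring Hg Hf).
    destruct (log_span_primitive w _ Hgf) as (G & SG & HG).
    exists (fun a b => c a * G b + - (c a * G a) * 1). split.
    - apply tensor_add; [apply tensor_r; assumption|].
      apply (tensor_l _ (fun a => - (c a * G a)) (fun _ => 1)).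
      + apply log_span_opp, log_span_mul; [exact mzv_ideal_span|assumption..].
      + apply log_span_const, mzv_ring_rational, rational_1.
    - intros a b Ha Hb.
      replace (c a * G b + - (c a * G a) * 1) with (scal (c a) (G b - G a)).
      2: { unfold scal; simpl; unfold mult; simpl. ring. }
      apply is_RInt_ext with (fun z => scal (c a) ((g z * f z) * density w z)).
      { intros z _. unfold scal; simpl; unfold mult; simpl. ring. }
      apply (is_RInt_scal (V := R_NormedModule)), is_RInt_primitive; assumption. }
  induction Hh as [c g Hc Hg|c g Hc Hg|h h' _ (H & TH & IH) _ (H' & TH' & IH')
                  |h h' E _ (H & TH & IH)].
  - apply Hbase; assumption.
  - apply Hbase; assumption.
  - exists (fun a b => H a b + H' a b). split; [apply tensor_add; assumption|].
    intros a b Ha Hb.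
    apply is_RInt_ext with
      (fun z => plus (h a z * (f z * density w z)) (h' a z * (f z * density w z))).
    { intros z _. unfold plus; simpl. ring. }
    apply (is_RInt_plus (V := R_NormedModule)); auto.
  - exists H. split; [exact TH|]. intros a b Ha Hb.
    apply is_RInt_ext with (2 := IH a b Ha Hb). intros z Hz.
    rewrite E; [reflexivity|exact Ha|].
    unfold Rmin, Rmax in Hz. destruct (Rle_dec a b); lra.
Qed.

Lemma log_tensor_mono (P P' : R -> Prop) (h : R -> R -> R) :
  (forall c, P c -> P' c) -> log_tensor P h -> log_tensor P' h.
Proof.
  intros HP. induction 1 as [c g Hc Hg|c g Hc Hg|h h' _ IH _ IH'|h h' E _ IH].
  - apply tensor_l; [apply (log_span_mono P); assumption|exact Hg].
  - apply tensor_r; [exact Hc|apply (log_span_mono P); assumption].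
  - apply tensor_add; assumption.
  - apply tensor_ext with (2 := IH). exact E.
Qed.

Lemma iter_int_tensor (f : nat -> R -> R) (w : nat -> form) (n : nat) :
  (forall i, (1 <= i <= S n)%nat -> log_span mzv_ring (f i)) ->
  log_tensor mzv_span (fun a b => iter_int f w a (S n) b).
Proof.
  assert (Hstep : forall m, log_span mzv_ring (f (S m)) ->
            log_tensor mzv_ring (fun a b => iter_int f w a m b) ->
            log_tensor mzv_span (fun a b => iter_int f w a (S m) b)).
  { intros m Hf Hm.
    destruct (log_tensor_integral _ (w (S m)) _ Hf Hm) as (H & TH & HH).
    apply tensor_ext with (2 := TH). intros a b Ha Hb. simpl. symmetry.
    apply (is_RInt_unique (V := R_CompleteNormedModule)). apply HH; assumption. }
  induction n as [|n IH]; intros Hf; apply Hstep.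
  - apply Hf. lia.
  - apply tensor_ext with (fun a b => 1 * 1); [intros; simpl; ring|].
    apply (tensor_l _ (fun _ => 1) (fun _ => 1));
      apply log_span_const, mzv_ring_rational, rational_1.
  - apply Hf. lia.
  - apply (log_tensor_mono mzv_span); [exact mzv_ring_span|]. apply IH.
    intros i Hi. apply Hf. lia.
Qed.

Lemma log_tensor_reg_lim_0 (P : R -> Prop) (h : R -> R -> R) : mzv_ideal P ->
  log_tensor P h ->
  exists G, log_span P G /\
    forall b, 0 < b < 1 -> reg_lim (at_right 0) ln (fun a => h a b) (G b).
Proof.
  intros HP.
  assert (Hbase : forall (c g : R -> R) (x : R), reg_lim (at_right 0) ln c x ->
            forall b, reg_lim (at_right 0) ln (fun a => c a * g b) (x * g b)).
  { intros c g x Hx b. rewrite (Rmult_comm x).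
    apply reg_lim_ext with (fun a => g b * c a).
    - apply filter_forall. intros a. ring.
    - apply reg_lim_scal, Hx. }
  induction 1 as [c g Hc Hg|c g Hc Hg|h h' _ (G & SG & IH) _ (G' & SG' & IH')
                 |h h' E _ (G & SG & IH)].
  - destruct (log_span_reg_lim_0 P c HP Hc) as (x & Hx & Hr).
    exists (fun b => x * g b). split; [|intros b _; apply Hbase, Hr].
    apply span_ext with (fun b => g b * x); [intros; ring|].
    apply log_span_mul; [exact HP|exact Hg|apply log_span_const, Hx].
  - destruct (log_span_reg_lim_0 _ c mzv_ideal_ring Hc) as (x & Hx & Hr).
    exists (fun b => x * g b). split; [|intros b _; apply Hbase, Hr].
    apply span_scal; assumption.
  - exists (fun b => G b + G' b). split; [apply span_add; assumption|].
    intros b Hb. apply (reg_lim_add ln (fun a => h a b)); auto.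
  - exists G. split; [exact SG|]. intros b Hb.
    apply reg_lim_ext with (2 := IH b Hb).
    generalize near_0. apply filter_imp. intros a Ha. apply E; assumption.
Qed.

Lemma ln_nonzero_near_0 : at_right 0 (fun z => ln z <> 0).
Proof.
  generalize near_0. apply filter_imp. intros z Hz. generalize (ln_neg z Hz). lra.
Qed.

Theorem theorem1p1 (N : nat) (f : nat -> R -> R) (w : nat -> form) (v : R)
    (HN : (1 <= N)%nat)
    (Hf : forall i : nat, (1 <= i <= N)%nat -> Plog (f i))
    (Hconv : is_iterated_integral N f w v) :
  is_Q_linear_combination_of_mzv v.
Proof.
  destruct N as [|n]; [lia|]. destruct Hconv as (F & HF & Hv).
  assert (T := iter_int_tensor f w n
                 (fun i Hi => Plog_log_span (f i) (Hf i Hi))).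
  destruct (log_tensor_reg_lim_0 _ _ mzv_ideal_span T) as (G & SG & HG).
  (* The limit exists, so it is the regularized one. *)
  assert (E : forall b, 0 < b < 1 -> F b = G b).
  { intros b Hb.
    exact (reg_lim_unique ln inv_ln_lim_0 ln_nonzero_near_0 _ _ _ (HG b Hb) (HF b Hb)). }
  destruct (log_span_reg_lim_1 _ G mzv_ideal_span SG) as (c & Hc & Hr).
  assert (LG : filterlim G (at_left 1) (locally v)).
  { apply filterlim_ext_loc with (2 := Hv).
    generalize near_1. apply filter_imp, E. }
  rewrite (reg_lim_unique Li1 inv_Li1_lim_1 Li1_nonzero_near_1 _ _ _ Hr LG). exact Hc.
Qed.
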